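(* Let $1<p<\infty$ and let $w$ be a weight in $X$. Assume that there exists a constant $C_1$ such that \[ \int_{X} \bigl(M^{*} f(x)\bigr)^p w(x)\,d\mu(x) \le C_1 \int_{X}f(x)^p w(x)\,d\mu(x) \] for all nonnegative functions $f\in L^\infty(X)$ with a bounded support. Then there exist constants $\varepsilon=\varepsilon(c_\mu,p,C_1)$ and $C=C(c_\mu,p,C_1)$ such that $0<\varepsilon<p-1$ and \[ \int_{X} \bigl(M^{*} f(x)\bigr)^{p-\varepsilon} w(x)\,d\mu(x) \le C\int_{X} \lvert f(x)\rvert^{p-\varepsilon} w(x)\,d\mu(x) \] for all $f\in L^{p-\varepsilon}(w\,d\mu)$.
   Context: $X=(X,d,\mu)$ is a metric measure space with a metric $d$ and a positive complete Borel measure $\mu$ such that $0<\mu(B)<\infty$ for all open balls $B=B(x,r)=\{y\in X: d(y,x)<r\}$, $x\in X$, $r>0$. All balls are such open balls. It is assumed that $X$ has at least two points and that $\mu$ is doubling: there is a constant $c_\mu>1$ with $\mu(B(x,2r))\le c_\mu\,\mu(B(x,r))$ for all $x\in X$, $r>0$. A measurable function $w\colon X\to\mathbb{R}$ is a weight in $X$ if $w$ is integrable (with respect to $\mu$) on all balls of $X$ and $w(x)>0$ for almost every $x\in X$. For $1\le q<\infty$, $L^q(w\,d\mu)$ is the set of measurable functions $f$ on $X$ with $\int_X |f|^q w\,d\mu<\infty$. $L^\infty(X)$ denotes the $\mu$-essentially bounded functions. A function has a bounded support if $\{x\in X: f(x)\neq 0\}$ is contained in some ball of $X$. The noncentered Hardy--Littlewood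 maximal function of a measurable function $f$ is \[ M^{*}f(x)=\sup_{B\ni x}\frac{1}{\mu(B)}\int_B |f(y)|\,d\mu(y), \] where the supremum is over all balls $B$ in $X$ containing $x$. The notation $C=C(a,b,\dots)$ means that the constant depends only on the listed parameters. *)

(* Defs.v *)
From HB Require Import structures.
From mathcomp Require Import all_boot all_order all_algebra.
From mathcomp Require Import all_classical all_reals all_analysis.
From mathcomp Require Import measurable_realfun.

Set Implicit Arguments.
Unset Strict Implicit.
Unset Printing Implicit Defensive.
Import Order.TTheory GRing.Theory Num.Theory.
Import numFieldNormedType.Exports.

Local Open Scope classical_set_scope.
Local Open Scope ring_scope.

(* The two structures are independent here: [complete_borel] below relates the
   sigma-algebra to the topology of the metric. *)
#[short(type="metricMeasurableType")]
HB.structure Definition MetricMeasurable (R : numDomainType)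
    (d : measure_display) :=
  { X of Metric R X & Measurable d X }.

Section metric_measure_space.
Context (R : realType) (d : measure_display) (X : metricMeasurableType R d).
Variable mu : {measure set X -> \bar R}.
Local Open Scope ereal_scope.

(* A complete Borel measure is the completion of its restriction to the Borel
   sigma-algebra: the measurable sets are exactly the unions of a Borel set and
   a subset of a mu-null Borel set. On a larger complete sigma-algebra Lebesgue
   differentiation can fail. *)
Definition complete_borel : Prop :=
  @measurable d X =
  completed_algebra_gen (T := g_sigma_algebraType (@open X)) mu.

Definition doubling (cmu : R) : Prop :=
  forall (x : X) (r : R), (0 < r)%R ->
    mu (ball x (2 * r)%R) <= cmu%:E * mu (ball x r).

Record doubling_metric_measure_space (cmu : R) : Prop := {
  dmms_borel : complete_borel;
  dmms_ball : forall (x : X) (r : R), (0 < r)%R -> 0 < mu (ball x r) < +oo;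
  dmms_two_points : exists x y : X, x <> y;
  dmms_doubling : doubling cmu }.

Record is_weight (w : X -> R) : Prop := {
  weight_measurable : measurable_fun [set: X] w;
  weight_integrable : forall (x : X) (r : R), (0 < r)%R ->
    mu.-integrable (ball x r) (EFin \o w);
  weight_gt0 : {ae mu, forall x, (0 < w x)%R} }.

Definition bounded_support (f : X -> R) : Prop :=
  exists (x : X) (r : R), (0 < r)%R /\ [set y | f y != 0%R] `<=` ball x r.

Definition weighted_Lq (q : R) (w f : X -> R) : Prop :=
  measurable_fun [set: X] f /\
  \int[mu]_x (`|f x| `^ q * w x)%:E < +oo.

Definition average (f : X -> R) (A : set X) : \bar R :=
  (mu A)^-1 * \int[mu]_(y in A) `|f y|%:E.

Definition maximal_function (f : X -> R) (x : X) : \bar R :=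
  ereal_sup [set average f (ball B.1 B.2) |
    B in [set B : X * R | (0 < B.2)%R /\ ball B.1 B.2 x]].

End metric_measure_space.

(* Main.v *)
Require Import Defs.
From HB Require Import structures.
From mathcomp Require Import all_boot all_order all_algebra.
From mathcomp Require Import all_classical all_reals all_analysis.
From mathcomp Require Import measurable_realfun.
From mathcomp Require Import ess_sup_inf ring lra.

(** * Self-improvement of the strong type maximal inequality

   The proof is a Rubio de Francia iteration; it never mentions the A_p
   condition, and it uses neither weak type estimates nor interpolation.

   Write M for the noncentered maximal operator and let A >= 1 bound its norm
   in L^p(w) (to the power p).  For a nonnegative F put
     v = sum_k (4A)^(-k) M^(k+1) F.
   Since M is countably sublinear, M v <= 4A v everywhere, so v is an A_1
   function whose constant depends on A only; and the choice of the ratio 4A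
   makes the series converge in L^p(w): the integral of v^p w is at most a
   constant times that of F^p w (lemma [integral_rubio_de_francia_le]).
   An A_1 function satisfies a reverse Hoelder inequality: for every small
   dl > 0 (how small depends on the doubling constant and on A), the mean of
   v^(1+dl) over a ball is at most a constant times v(x)^(1+dl) for each x in
   the ball.  As F <= C v almost everywhere ([le_emaximal_ae]), the same bound holds for
   F^(1+dl) ([dominated_reverse_hoelder]).  Taking F = |f|^(1/(1+dl)), this
   says M f <= C v^(1+dl), and raising to the power q = p/(1+dl) gives
     int (M f)^q w <= C int v^p w <= C' int F^p w = C' int |f|^q w.
   So eps = p - q, and taking dl < p - 1 makes eps < p - 1.

   Three points need care in a metric space without compactness.
   - M F, hence v, is lower semicontinuous.  This makes all the iterates
     measurable and lets stopping balls be chosen at every point of a level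
     set of v, without a differentiation theorem.
   - Instead of the differentiation theorem, F <= C M F almost everywhere is
     enough; it follows from the covering estimate [vitali_integral_le] and
     from outer regularity of mu, where it matters that every measurable set is
     Borel up to a null set.
   - The reverse Hoelder inequality is first shown for bounded functions that
     are bounded away from zero ([bounded_reverse_hoelder]).  For these some
     constant S is available at once; a layer decomposition along stopping
     balls replaces S by K^2 + S/2, with K the A_1 constant, and iterating
     this removes every dependence on the bounds. *)

Set Implicit Arguments.
Unset Strict Implicit.
Unset Printing Implicit Defensive.
Import Order.TTheory GRing.Theory Num.Theory.
Import numFieldNormedType.Exports.
Local Open Scope classical_set_scope.
Local Open Scope ring_scope.

(** * Balls in a metric space *)

Section metric_balls.
Context (R : realType) (X : metricType R).
Implicit Types (x y z : X) (r s : R) (U : set X).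

Lemma in_ball x r y : ball x r y = (mdist x y < r) :> Prop.
Proof. by rewrite ballEmdist. Qed.

Lemma subset_ball_add x y r s : mdist y x + r <= s -> ball x r `<=` ball y s.
Proof.
move=> h z; rewrite !in_ball => xz; apply: le_lt_trans (metric_triangle y x z) _.
by apply: lt_le_trans h; rewrite ltrD2l.
Qed.

Lemma open_ball_in U x : open U -> U x -> exists2 r, 0 < r & ball x r `<=` U.
Proof.
move=> oU Ux; have := open_nbhs_nbhs (conj oU Ux).
by rewrite -nbhs_ballE => -[r /= r0 rU]; exists r.
Qed.

Lemma open_from_balls U :
  (forall x, U x -> exists2 r, 0 < r & ball x r `<=` U) -> open U.
Proof.
move=> h; rewrite openE => x /h[r r0 rU].
by rewrite /interior -nbhs_ballE; exists r.
Qed.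

Lemma metric_ball_open x r : open (ball x r).
Proof.
apply: open_from_balls => y; rewrite in_ball => xy.
exists (r - mdist x y); first by rewrite subr_gt0.
by apply: subset_ball_add; rewrite addrC subrK.
Qed.

End metric_balls.

(** * Vitali covering *)

Section vitali.
Context (R : realType) (d : measure_display) (X : metricMeasurableType R d).
Variable mu : {measure set X -> \bar R}.
Implicit Types (x y z : X) (s : X -> R) (E U : set X).

(** Zorn is applied to the disjoint subfamilies that are greedy up to a factor
    2: any ball of the family meeting the subfamily meets a member of at least
    half its radius. This heredity condition is what makes a maximal subfamily
    meet every ball: among the balls missed, one whose radius is at least half
    the supremum of the missed radii could be added. *)
Lemma vitali_selection E s rmax : (forall y, E y -> 0 < s y <= rmax) ->
  exists D : set X, [/\ D `<=` E, trivIset D (fun y => ball y (s y)) &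
    forall y, E y -> exists2 z, D z & ball y (s y) `<=` ball z (5 * s z)].
Proof.
move=> hs.
pose meets y z := ball y (s y) `&` ball z (s z) !=set0.
pose P (D : set X) := [/\ D `<=` E, trivIset D (fun y => ball y (s y)) &
  forall y, E y -> (exists2 z, D z & meets y z) ->
    exists z, [/\ D z, meets y z & s y <= 2 * s z]].
have [D [[DE tD hD] Dmax]] : exists D, P D /\ forall D', D `<` D' -> ~ P D'.
  apply: Zorn_bigcup => F FP tF; split.
  - by apply: bigcup_sub => D /FP[].
  - move=> y z [D1 FD1 D1y] [D2 FD2 D2z] yz.
    have [D12|D21] := tF _ _ FD1 FD2.
    + by have [_ t _] := FP _ FD2; exact: t (D12 _ D1y) D2z yz.
    + by have [_ t _] := FP _ FD1; exact: t D1y (D21 _ D2z) yz.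
  - move=> y Ey [z [D FD Dz] yz]; have [_ _ h] := FP _ FD.
    have [z' [Dz' yz' ss]] := h y Ey (ex_intro2 _ _ z Dz yz).
    by exists z'; split => //; exists D.
have cover y : E y -> exists2 z, D z & meets y z.
  move=> Ey; apply: contrapT => nm.
  pose A := [set s u | u in [set u | E u /\ ~ exists2 z, D z & meets u z]].
  have Asup : has_sup A.
    split; first by exists (s y), y.
    by exists rmax => _ [u [Eu _] <-]; have /andP[] := hs _ Eu.
  have sy : s y <= sup A by apply: ub_le_sup; [exact: Asup.2|exists y].
  have [sy0 _] := andP (hs _ Ey).
  (* u is a missed ball of nearly maximal radius among the missed ones *)
  have [|_ [u [Eu nu] <-] su] := @sup_adherent _ A (sup A / 2) _ Asup.
    by rewrite divr_gt0// (lt_le_trans sy0).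
  have [su0 _] := andP (hs _ Eu).
  have uu : ball u (s u) u by exact: ballxx.
  apply: (Dmax (D `|` [set u])).
    split; first by move=> v; left.
    move=> DD; have /DD Du : (D `|` [set u]) u by right.
    by apply: nu; exists u => //; exists u.
  split.
  - by move=> v [/DE//|->].
  - move=> v w [Dv|->] [Dw|->] [t [vt wt]] //.
    + by apply: tD => //; exists t.
    + by exfalso; apply: nu; exists v => //; exists t.
    + by exfalso; apply: nu; exists w => //; exists t.
  - move=> v Ev [w [Dw|->] vw].
      have [w' [? ? ?]] := hD v Ev (ex_intro2 _ _ w Dw vw).
      by exists w'; split => //; left.
    have [[w' Dw' vw']|nv] := pselect (exists2 z, D z & meets v z).
      have [w'' [? ? ?]] := hD v Ev (ex_intro2 _ _ w' Dw' vw').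
      by exists w''; split => //; left.
    exists u; split => //; first by right.
    have : s v <= sup A by apply: ub_le_sup; [exact: Asup.2|exists v].
    by move=> /le_trans; apply; lra.
exists D; split => // y Ey; have [z [Dz yz ss]] := hD y Ey (cover y Ey).
exists z => //; apply: subset_ball_add.
case: yz => t []; rewrite !in_ball => yt zt.
have := metric_triangle z t y; rewrite (metric_sym t y) => tri.
by apply: le_trans (lerD tri (lexx _)) _; lra.
Qed.

(** For each n only finitely many of the sets have measure above 1/(n+1),
    since all of them fit disjointly into a set of finite measure. *)
Lemma trivIset_countable (J : Type) (D : set J) (B : J -> set X) U :
  measurable U -> (mu U < +oo)%E -> trivIset D B ->
  (forall i, D i -> [/\ measurable (B i), B i `<=` U & (0 < mu (B i))%E]) ->
  countable D.
Proof.
elim/Ppointed: J => J in D B *; first by rewrite emptyE.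
move=> mU Ufin tB hB.
have fin i : D i -> mu (B i) \is a fin_num.
  move=> /hB[mB BU _]; rewrite ge0_fin_numE//.
  by apply: le_lt_trans Ufin; apply: le_measure => //; rewrite inE.
rewrite [X in countable X](_ : _ =
    \bigcup_n [set i | D i /\ n.+1%:R^-1 < fine (mu (B i))]); last first.
  apply/seteqP; split=> [i Di|i [k _ []]//].
  have [_ _ B0] := hB _ Di.
  have : 0 < fine (mu (B i)) by rewrite fine_gt0// B0 ltey_eq fin.
  by move=> /ltr_add_invr[k]; rewrite add0r => ?; exists k.
apply: bigcup_countable => // n _; apply: finite_set_countable.
apply: contrapT => /infiniteP/pcard_leP/injfunPex[/= q q_fun q_inj].
have Dq k : D (q k) by have [] := q_fun k I.
have mq k : measurable (B (q k)) by have [] := hB _ (Dq k).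
have Uf : mu U \is a fin_num by rewrite ge0_fin_numE.
have [N hN] : exists N : nat, fine (mu U) * n.+1%:R < N%:R.
  exists (Num.bound `|fine (mu U) * n.+1%:R|).
  by apply: le_lt_trans (archi_boundP (normr_ge0 _)); rewrite ler_norm.
have : (mu (\bigcup_k B (q k)) <= mu U)%E.
  apply: le_measure; rewrite ?inE//; first exact: bigcup_measurable.
  by apply: bigcup_sub => k _; have [] := hB _ (Dq k).
rewrite leNgt => /negP; apply.
rewrite measure_bigcup//; last first.
  move=> i j _ _ ij; apply: q_inj; rewrite ?inE//.
  exact: tB (Dq i) (Dq j) ij.
rewrite (eq_eseriesl (Q := xpredT)); last by move=> i; rewrite in_setT.
apply: (lt_le_trans _ (nneseries_lim_ge N _)) => //.
rewrite -EFin_sum_fine//; last by move=> i _; exact: fin.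
rewrite -(fineK Uf) lte_fin.
have : N%:R * n.+1%:R^-1 <= \sum_(0 <= k < N) fine (mu (B (q k))).
  rewrite (_ : N%:R * _ = \sum_(0 <= k < N) n.+1%:R^-1); last first.
    by rewrite sumr_const_nat subn0 mulr_natl.
  by apply: ler_sum => k _; apply: ltW; have [] := q_fun k I.
by apply: lt_le_trans; rewrite ltr_pdivlMr.
Qed.
End vitali.

(** * Covering estimates for a doubling measure *)

Section doubling_space.
Context (R : realType) (d : measure_display) (X : metricMeasurableType R d).
Variables (mu : {measure set X -> \bar R}) (cmu : R).
Hypothesis H : doubling_metric_measure_space mu cmu.
Implicit Types (x y z : X) (s : X -> R) (E U : set X).
Local Open Scope ereal_scope.

Lemma open_measurable_metric U : open U -> measurable U.
Proof.
move=> oU; rewrite (dmms_borel H); exists U; first exact: sub_sigma_algebra.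
by exists set0; rewrite ?setU0//; exists set0; split;
    [exact: measurable0|exact: measure0|by []].
Qed.

Lemma measurable_metric_ball x (r : R) : measurable (ball x r).
Proof. by apply: open_measurable_metric; exact: metric_ball_open. Qed.
Hint Resolve measurable_metric_ball : core.

Lemma ball_measure_gt0 x (r : R) : (0 < r)%R -> 0 < mu (ball x r).
Proof. by move=> /(dmms_ball H x)/andP[]. Qed.

Lemma ball_measure_lty x (r : R) : (0 < r)%R -> mu (ball x r) < +oo.
Proof. by move=> /(dmms_ball H x)/andP[]. Qed.

Lemma ball_measure_fin x (r : R) : (0 < r)%R -> mu (ball x r) \is a fin_num.
Proof. by move=> r0; rewrite ge0_fin_numE// ball_measure_lty. Qed.

Lemma ball_fine_gt0 x (r : R) : (0 < r)%R -> (0 < fine (mu (ball x r)))%R.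
Proof.
by move=> r0; rewrite fine_gt0// ball_measure_gt0// ball_measure_lty.
Qed.

Lemma doubling_iter x (r : R) k : (0 <= cmu)%R -> (0 < r)%R ->
  mu (ball x (2 ^+ k * r)%R) <= (cmu ^+ k)%:E * mu (ball x r).
Proof.
move=> c0 r0; elim: k => [|k IH]; first by rewrite !expr0 mul1r mul1e.
rewrite exprS -mulrA; apply: le_trans (dmms_doubling H _ _) _.
  by rewrite mulr_gt0// exprn_gt0.
by rewrite exprS EFinM -muleA lee_wpmul2l// lee_fin.
Qed.

Lemma integral_bigcup_le (F : (set X)^nat) (V : X -> \bar R) :
  (forall k, measurable (F k)) -> measurable_fun [set: X] V ->
  (forall x, 0 <= V x) ->
  \int[mu]_(x in \bigcup_k F k) V x <= \sum_(k <oo) \int[mu]_(x in F k) V x.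
Proof.
move=> mF mV V0.
have mD k : measurable (seqDU F k).
  by apply: measurableD => //; exact: bigsetU_measurable.
rewrite seqDU_bigcup_eq ge0_integral_bigcup//; last exact: measurable_funTS.
apply: lee_nneseries => [n _ _|n _]; first by apply: integral_ge0.
by apply: ge0_subset_integral => //; [exact: measurable_funTS|exact: subset_seqDU].
Qed.

(** The only way covering enters the proof: if the integral over each dilated
    ball is controlled by the measure of the ball, then the integral over the
    set of centers is controlled by the measure of any set containing the
    balls. *)
Lemma vitali_integral_le E U s (rmax c : R) (V : X -> \bar R) :
  measurable E -> measurable U -> mu U < +oo -> (0 <= c)%R ->
  measurable_fun [set: X] V -> (forall x, 0 <= V x) ->
  (forall y, E y -> [/\ (0 < s y <= rmax)%R, ball y (s y) `<=` U &
    \int[mu]_(x in ball y (5 * s y)%R) V x <= c%:E * mu (ball y (s y))]) ->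
  \int[mu]_(x in E) V x <= c%:E * mu U.
Proof.
move=> mE mU Ufin c0 mV V0 hE.
have [|D [DE tD hD]] := @vitali_selection R d X E s rmax.
  by move=> y /hE[].
have Dcount : countable D.
  apply: (trivIset_countable mU Ufin tD) => y /DE/hE[/andP[s0 _] sU _].
  by split => //; exact: ball_measure_gt0.
have [f finj] := countable_injP D Dcount.
(* indexing D by nat through f; P n and Q n are one ball each, or empty *)
pose sel n := D `&` f @^-1` [set n].
pose P n := \bigcup_(y in sel n) ball y (s y).
pose Q n := \bigcup_(y in sel n) ball y (5 * s y)%R.
have selP n : sel n = set0 \/ exists2 y, D y & sel n = [set y].
  have [->|/set0P[y [Dy fy]]] := eqVneq (sel n) set0; [by left|right].
  exists y => //; apply/seteqP; split => [z [Dz fz]/=|z ->//].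
  by apply: finj; rewrite ?inE// fz.
have mP n : measurable (P n).
  by rewrite /P; have [->|[y _ ->]] := selP n; rewrite ?bigcup_set0 ?bigcup_set1.
have mQ n : measurable (Q n).
  by rewrite /Q; have [->|[y _ ->]] := selP n; rewrite ?bigcup_set0 ?bigcup_set1.
have tP : trivIset setT P.
  move=> m n _ _ [t [[y [Dy fy] yt] [z [Dz fz] zt]]].
  by rewrite -fy -fz (tD _ _ Dy Dz)//; exists t.
apply: (@le_trans _ _ (\int[mu]_(x in \bigcup_n Q n) V x)).
  apply: ge0_subset_integral => //; [exact: bigcup_measurable|exact: measurable_funTS|].
  move=> y Ey; have [z Dz yz] := hD y Ey.
  exists (f z) => //; exists z => //; apply: yz; apply: ballxx.
  by have [/andP[]] := hE _ Ey.
apply: le_trans (integral_bigcup_le mQ mV V0) _.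
apply: (@le_trans _ _ (\sum_(n <oo) c%:E * mu (P n))).
  apply: lee_nneseries => [n _ _|n _]; first by apply: integral_ge0.
  rewrite /P /Q; have [->|[y Dy ->]] := selP n.
    by rewrite !bigcup_set0 integral_set0 mule_ge0// lee_fin.
  by rewrite !bigcup_set1; have [_ _] := hE _ (DE _ Dy).
rewrite nneseriesZl; last by move=> n _; exact: measure_ge0.
rewrite lee_wpmul2l ?lee_fin//.
have -> : \sum_(n <oo) mu (P n) = mu (\bigcup_n P n).
  rewrite measure_bigcup//; apply: eq_eseriesl => n.
  by rewrite in_setT.
apply: le_measure; rewrite ?inE//; first exact: bigcup_measurable.
by move=> t [n _ [y [Dy _] yt]]; have [_ + _] := hE _ (DE _ Dy); apply.
Qed.

End doubling_space.

(** * Outer regularity *)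

Section regularity.
Context (R : realType) (d : measure_display) (X : metricMeasurableType R d).
Variables (mu : {measure set X -> \bar R}) (cmu : R).
Hypothesis H : doubling_metric_measure_space mu cmu.
Implicit Types (x y z : X) (A F U : set X).
Local Open Scope ereal_scope.

Let mopen := open_measurable_metric H.
Let mball := measurable_metric_ball H.

Section in_a_ball.
Variables (x0 : X) (r0 : R).
Hypothesis r0_gt0 : (0 < r0)%R.
Local Notation B := (ball x0 r0).

(** Continuity from above, inside a ball because mu itself may be infinite. *)
Lemma nondecreasing_exhausts_ball (F : (set X)^nat) (e : R) : (0 < e)%R ->
  (forall n, measurable (F n)) -> nondecreasing_seq F ->
  exists n, mu ((\bigcup_n F n `\` F n) `&` B) <= e%:E.
Proof.
move=> e0 mF ndF; pose G n := (\bigcup_n F n `\` F n) `&` B.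
have mU : measurable (\bigcup_n F n) by exact: bigcup_measurable.
have mG n : measurable (G n) by apply: measurableI => //; exact: measurableD.
have niG : nonincreasing_seq G.
  move=> m n mn; apply/subsetPset => t [[Ut nFt] Bt]; split => //; split => //.
  by apply: contra_not nFt; have /subsetPset := ndF _ _ mn; exact.
have G0 : \bigcap_n G n = set0.
  apply/seteqP; split => // t Gt; have [[[n _ Fnt] _] _] := Gt 0%N I.
  by have [[_ +] _] := Gt n I; exact.
have := @nonincreasing_cvg_mu _ X R mu G _ mG _ niG.
rewrite G0 measure0 => cv.
have /cv {}cv : mu (G 0%N) < +oo.
  apply: le_lt_trans (ball_measure_lty H x0 r0_gt0).
  by apply: le_measure; rewrite ?inE//; apply: subIsetr.
have {}cv := cv measurable0.
have [n _ /(_ n (leqnn n)) hn] := cv _ (@nbhs_open_ereal_lt R 0 (fun=> e) e0).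
by exists n; exact: ltW.
Qed.

(** Squeezing A between a closed and an open set, rather than just from
    outside, makes the property stable under complements; this is why it holds
    on the whole Borel sigma-algebra. *)
Definition borel_regular A := forall e : R, (0 < e)%R ->
  exists F U, [/\ closed F, open U, F `<=` A, A `<=` U &
    mu ((U `\` F) `&` B) <= e%:E].

(** An open set is the increasing union of the closed sets of points at
    distance at least 1/(n+1) from its complement. *)
Lemma borel_regular_open U : open U -> borel_regular U.
Proof.
move=> oU e e0; pose F n := [set x | ball x n.+1%:R^-1 `<=` U].
have cF n : closed (F n).
  rewrite -openC; apply: open_from_balls => x /= /existsNP[y /not_implyP[xy nUy]].
  exists (n.+1%:R^-1 - mdist x y)%R.
    by move: xy; rewrite in_ball subr_gt0.
  move=> z; rewrite in_ball => xz /(_ y) h; apply: nUy; apply: h.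
  rewrite in_ball; apply: le_lt_trans (metric_triangle z x y) _.
  by rewrite (metric_sym z x) -ltrBrDr.
have mF n : measurable (F n) by rewrite -(setCK (F n)); apply/measurableC/mopen; rewrite openC.
have ndF : nondecreasing_seq F.
  move=> m n mn; apply/subsetPset => x Fx; apply: subset_trans Fx.
  by apply: subset_ball_add; rewrite mdistxx add0r lef_pV2 ?posrE// ler_nat.
have FU : \bigcup_n F n = U.
  apply/seteqP; split => [x [n _]|x Ux].
    by apply; apply: ballxx.
  have [r rgt0 rU] := open_ball_in oU Ux.
  have [k] := ltr_add_invr rgt0; rewrite add0r => kr.
  exists k => //; apply: subset_trans rU.
  by apply: subset_ball_add; rewrite mdistxx add0r ltW.
have [n hn] := nondecreasing_exhausts_ball e0 mF ndF.
by exists (F n), U; split => //; rewrite -FU// => x; exists n.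
Qed.

Lemma borel_regular_sigma : sigma_algebra [set: X] borel_regular.
Proof.
split.
- move=> e e0; exists set0, set0; split => //; [exact: closed0|exact: open0|].
  by rewrite setD0 set0I measure0 lee_fin ltW.
- move=> A rA e e0; have [F [U [cF oU FA AU UF]]] := rA e e0.
  exists (~` U), (~` F); split.
  + by rewrite closedC.
  + by rewrite openC.
  + by move=> x nUx; split => // /AU.
  + by move=> x [_ nAx] /FA.
  + by have -> : ~` F `\` ~` U = U `\` F by rewrite setDE setCK setIC -setDE.
- move=> A rA e e0.
  have e2 : (0 < e / 2)%R by rewrite divr_gt0.
  have /choice[F /choice[U FU]] : forall n, exists F, exists U,
      [/\ closed F, open U, F `<=` A n, A n `<=` U &
        mu ((U `\` F) `&` B) <= (e / 2 / (2 ^ n.+1)%:R)%:E].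
    by move=> n; apply: rA; rewrite divr_gt0// ltr0n expn_gt0.
  (* an infinite union of closed sets need not be closed: keep finitely many *)
pose FN N := \big[setU/set0]_(i < N.+1) F i.
  have cFN N : closed (FN N).
    by apply: closed_bigsetU => i _; have [] := FU i.
  have mF n : measurable (F n).
    by rewrite -(setCK (F n)); apply/measurableC/mopen; rewrite openC; have [] := FU n.
  have mU n : measurable (U n) by apply: mopen; have [] := FU n.
  have mFN n : measurable (FN n) by exact: bigsetU_measurable.
  have [|N hN] := nondecreasing_exhausts_ball e2 mFN _.
    by move=> m n mn; apply/subsetPset; exact: subset_bigsetU.
  have FNE : \bigcup_n FN n = \bigcup_n F n.
    by rewrite bigcup_bigsetU_bigcup.
  rewrite FNE in hN.
  exists (FN N), (\bigcup_n U n); split => //.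
  + by apply: bigcup_open => n _; have [] := FU n.
  + move=> x /(@bigsetU_bigcup _ F)[n _ Fx]; exists n => //.
    by have [_ _ + _ _] := FU n; exact.
  + by move=> x [n _ Ax]; exists n => //; have [_ _ _ + _] := FU n; exact.
  + have mUF n : measurable ((U n `\` F n) `&` B).
      by apply: measurableI => //; exact: measurableD.
    apply: (@le_trans _ _ (mu (\bigcup_n ((U n `\` F n) `&` B) `|`
        ((\bigcup_n F n `\` FN N) `&` B)))).
      apply: le_measure; rewrite ?inE.
      * by apply: measurableI => //; apply: measurableD => //; exact: bigcup_measurable.
      * apply: measurableU; first exact: bigcup_measurable.
        by apply: measurableI => //; apply: measurableD => //; exact: bigcup_measurable.
      * move=> x [[[n _ Ux] nFx] Bx].
        have [Fx|nF] := pselect (F n x); [right|left; exists n => //].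
        by split => //; split => //; exists n.
    apply: le_trans (measureU2 _ _ _) _ => //.
    * exact: bigcup_measurable.
    * by apply: measurableI => //; apply: measurableD => //; exact: bigcup_measurable.
    rewrite (splitr e) EFinD leeD//.
    apply: le_trans (@epsilon_trick0 R (e / 2) xpredT (ltW e2)).
    apply: le_trans (@generalized_Boole_inequality _ _ _ mu
      (fun n => (U n `\` F n) `&` B) _ _) _ => //; first exact: bigcup_measurable.
    by apply: lee_nneseries => // n _; have [] := FU n.
Qed.

(** A measurable set is a Borel set up to a subset of a null Borel set, and
    both of these Borel sets have small open neighbourhoods. *)
Lemma outer_regular_in_ball A (e : R) : measurable A -> (0 < e)%R ->
  exists U, [/\ open U, A `<=` U & mu (U `&` B) <= mu (A `&` B) + e%:E].
Proof.
have reg C : <<s @open X >> C -> borel_regular C.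
  by apply: smallest_sub; [exact: borel_regular_sigma|exact: borel_regular_open].
have bor C : <<s @open X >> C -> measurable C.
  move=> mC; rewrite (dmms_borel H); exists C => //.
  by exists set0; rewrite ?setU0//; exists set0; split;
    [exact: measurable0|exact: measure0|by []].
have out C (e' : R) : <<s @open X >> C -> (0 < e')%R ->
    exists U, [/\ open U, C `<=` U & mu (U `&` B) <= mu (C `&` B) + e'%:E].
  move=> mC e0; have [F [U [cF oU FC CU UF]]] := reg C mC e' e0.
  have mF : measurable F by rewrite -(setCK F); apply/measurableC/mopen; rewrite openC.
  have mU := mopen oU.
  exists U; split => //.
  apply: (@le_trans _ _ (mu ((C `&` B) `|` ((U `\` F) `&` B)))).
    apply: le_measure; rewrite ?inE.
    + exact: measurableI.
    + apply: measurableU; apply: measurableI => //; [exact: bor|exact: measurableD].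
    + move=> x [Ux Bx]; have [Cx|nCx] := pselect (C x); [by left|right].
      by split => //; split => // /FC.
  apply: le_trans (measureU2 _ _ _) _.
  + by apply: measurableI => //; exact: bor.
  + by apply: measurableI => //; exact: measurableD.
  + by rewrite leeD2l.
move=> mA0 e0; have e2 : (0 < e / 2)%R by rewrite divr_gt0.
move: (mA0); rewrite (dmms_borel H).
move=> [C mC [N [N0 [mN0 muN0 NN0]] <-]].
have [U [oU CU hU]] := out C _ mC e2.
have [V [oV NV hV]] := out N0 _ mN0 e2.
have mA : @measurable d X (C `|` N).
  by rewrite (dmms_borel H); exists C => //; exists N => //; exists N0.
exists (U `|` V); split; first exact: openU.
  by move=> x [/CU|/NN0/NV]; [left|right].
rewrite setIUl; apply: le_trans (measureU2 _ _ _) _.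
- by apply: measurableI => //; exact: mopen.
- by apply: measurableI => //; exact: mopen.
apply: le_trans (leeD hU hV) _.
have -> : mu (N0 `&` B) = 0.
  apply/eqP; rewrite eq_le measure_ge0 andbT -muN0 le_measure ?inE//.
  - by apply: measurableI => //; exact: bor.
  - exact: bor.
rewrite add0e -addeA -EFinD -splitr leeD2r// le_measure ?inE//.
- by apply: measurableI => //; exact: bor.
- exact: measurableI.
- by apply: setSI => x; left.
Qed.
End in_a_ball.
End regularity.

(** * The maximal operator *)

Section maximal_operator.
Context (R : realType) (d : measure_display) (X : metricMeasurableType R d).
Variables (mu : {measure set X -> \bar R}) (cmu : R).
Hypothesis H : doubling_metric_measure_space mu cmu.
Implicit Types (x y z : X) (f g : X -> \bar R).
Local Open Scope ereal_scope.

Let mopen := open_measurable_metric H.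
Let mball := measurable_metric_ball H.

(** Values in the extended reals allow the operator to be iterated. *)
Definition emaximal f x : \bar R :=
  ereal_sup [set (mu (ball B.1 B.2))^-1 * \int[mu]_(y in ball B.1 B.2) f y |
    B in [set B : X * R | (0 < B.2)%R /\ ball B.1 B.2 x]].

Lemma measurable_open_superlevels f :
  (forall a : R, open [set x | a%:E < f x]) -> measurable_fun [set: X] f.
Proof.
move=> of_; apply: (measurability _ (ErealGenOInfty.measurableE R)).
move=> /= _ [_ [a ->]] <-; apply: measurableI => //; apply: mopen.
rewrite (_ : _ @^-1` _ = [set x | a%:E < f x])//.
by apply/seteqP; split => x /=; rewrite in_itv/= andbT.
Qed.

(** All later estimates of the maximal function go through this form, which
    avoids the inverse of an extended real. *)
Lemma emaximal_leP f x (t : \bar R) :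
  emaximal f x <= t <->
  (forall z r, (0 < r)%R -> ball z r x ->
    \int[mu]_(y in ball z r) f y <= t * mu (ball z r)).
Proof.
have avgE z r : (0 < r)%R ->
    ((mu (ball z r))^-1 * \int[mu]_(y in ball z r) f y <= t) =
    (\int[mu]_(y in ball z r) f y <= t * mu (ball z r)).
  move=> r0; have f0 := ball_fine_gt0 H z r0.
  rewrite -(fineK (ball_measure_fin H z r0)) inver gt_eqF// muleC.
  by rewrite lee_pdivrMr.
split => [h z r r0 zx|h].
  rewrite -avgE//; apply: le_trans h; apply: ereal_sup_ubound.
  by exists (z, r).
by apply: ge_ereal_sup => _ [[z r] [/= r0 zx] <-]; rewrite avgE//; exact: h.
Qed.

Lemma integral_ball_le_emaximal f x z r : (0 < r)%R -> ball z r x ->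
  \int[mu]_(y in ball z r) f y <= emaximal f x * mu (ball z r).
Proof. by have [/(_ (lexx _)) + _] := emaximal_leP f x (emaximal f x); apply. Qed.

Lemma emaximal_ge0 f x : (forall y, 0 <= f y) -> 0 <= emaximal f x.
Proof.
move=> f0.
apply: (@le_trans _ _ ((mu (ball x 1))^-1 * \int[mu]_(y in ball x 1) f y)).
  by rewrite mule_ge0 ?inve_ge0//; apply: integral_ge0.
by apply: ereal_sup_ubound; exists (x, 1%R) => //; split => //; apply: ballxx.
Qed.

(** A ball containing x is a neighbourhood of x, so a noncentered average that
    exceeds a at x does so nearby. *)
Lemma emaximal_open f (a : \bar R) : open [set x | a < emaximal f x].
Proof.
apply: open_from_balls => x /= /ereal_sup_gt[_ [[z r] /= [r0 zx] <-] afzr].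
have [e e0 eB] := open_ball_in (metric_ball_open z r) zx.
exists e => // y /eB zy; apply: lt_le_trans afzr _.
by apply: ereal_sup_ubound; exists (z, r).
Qed.

Lemma measurable_emaximal f : measurable_fun [set: X] (emaximal f).
Proof. by apply: measurable_open_superlevels => a; exact: emaximal_open. Qed.

(** Cover E by balls inside an open set U barely larger than E. On dilated
    balls centered in E the mean of f is at most q divided by 2 cmu^3, so the
    covering estimate gives q mu(E) <= (q/2) mu(U), hence mu(E) <= mu(U) / 2.
    *)
Lemma emaximal_small_level_null f (C q r0 : R) (E : set X) x0 :
  (cmu ^+ 3 * 2 <= C)%R -> (0 <= cmu)%R -> (0 < r0)%R ->
  measurable E -> E `<=` ball x0 r0 -> (0 < q)%R ->
  measurable_fun [set: X] f -> (forall x, 0 <= f x) ->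
  (forall x, E x -> q%:E <= f x /\ C%:E * emaximal f x <= q%:E) ->
  mu E = 0.
Proof.
move=> hC c0 r0_gt0 mE EB q0 mf f0 hE.
have Efin : mu E \is a fin_num.
  rewrite ge0_fin_numE//; apply: le_lt_trans (ball_measure_lty H x0 r0_gt0).
  by apply: le_measure; rewrite ?inE.
apply/eqP; rewrite eq_le measure_ge0 andbT.
apply/lee_addgt0Pr => e e0; rewrite add0e.
have [U [oU EU hU]] := outer_regular_in_ball H x0 r0_gt0 mE e0.
pose U' := U `&` ball x0 r0.
have oU' : open U' by apply: openI => //; exact: metric_ball_open.
have /choice[s hs] : forall y, exists r, E y -> (0 < r <= 1)%R /\ ball y r `<=` U'.
  move=> y; have [Ey|nE] := pselect (E y); last by exists 0%R.
  have [|r rgt0 rU] := @open_ball_in _ _ U' y oU'.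
    by split; [exact: EU|exact: EB].
  exists (Num.min r 1%R) => _; split; first by rewrite lt_min rgt0 ltr01 ge_min lexx orbT.
  apply: subset_trans rU; apply: subset_ball_add.
  by rewrite mdistxx add0r ge_min lexx.
have key : \int[mu]_(x in E) f x <= (q / 2)%:E * mu U'.
  apply: (@vitali_integral_le _ _ _ _ _ H _ _ s 1 (q / 2)) => //.
  - exact: mopen.
  - apply: le_lt_trans (ball_measure_lty H x0 r0_gt0).
    by apply: le_measure; rewrite ?inE//; [exact: mopen|apply: subIsetr].
  - by rewrite divr_ge0// ltW.
  - move=> y Ey; have [s01 sU] := hs y Ey; split => //.
    have /andP[s0 _] := s01.
    have s50 : (0 < 5 * s y)%R by rewrite mulr_gt0.
    have [qf MC] := hE y Ey.
    apply: le_trans (@integral_ball_le_emaximal f y y _ s50 _) _; first exact: ballxx.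
    apply: (@le_trans _ _ (emaximal f y * ((cmu ^+ 3)%:E * mu (ball y (s y))))).
      rewrite lee_wpmul2l ?emaximal_ge0//.
      apply: le_trans (doubling_iter H y 3 c0 s0).
      apply: le_measure; rewrite ?inE//; apply: subset_ball_add.
      by rewrite mdistxx add0r ler_pM2r//; lra.
    rewrite muleA lee_wpmul2r// [leRHS]EFinM lee_pdivlMr//.
    apply: le_trans MC; rewrite -muleA -EFinM muleC lee_wpmul2r ?emaximal_ge0//.
have qE : q%:E * mu E <= \int[mu]_(x in E) f x.
  rewrite -integral_cst//; apply: ge0_le_integral => //.
  - by move=> x _; rewrite lee_fin ltW.
  - exact: measurable_funTS.
  - by move=> x /hE[].
have {}qE : q%:E * mu E <= (q / 2)%:E * (mu E + e%:E).
  apply: le_trans qE (le_trans key _); rewrite lee_wpmul2l ?lee_fin ?divr_ge0 ?(ltW q0)//.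
  by apply: le_trans hU _; rewrite leeD2r// le_measure ?inE//; exact: measurableI.
move: qE; rewrite -(fineK Efin) -EFinD -!EFinM !lee_fin => qE.
suff : (q * fine (mu E) <= q * e)%R by rewrite ler_pM2l.
by lra.
Qed.

(** Plays the role of the Lebesgue differentiation theorem. The exceptional
    set is a countable union, over rational levels and balls, of null sets. *)
Lemma le_emaximal_ae f (C : R) (x0 : X) :
  (0 < C)%R -> (cmu ^+ 3 * 2 <= C)%R -> (0 <= cmu)%R ->
  measurable_fun [set: X] f -> (forall x, 0 <= f x) ->
  {ae mu, forall x, f x <= C%:E * emaximal f x}.
Proof.
move=> C0 hC c0 mf f0.
have mM : measurable_fun [set: X] (fun x => C%:E * emaximal f x).
  by apply: emeasurable_funM => //; exact: measurable_emaximal.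
(* q enumerates the rationals, with default value 0 *)
pose q (k : nat) : R := ratr (odflt 0%R (unpickle k) : rat).
pose E k n := if (0 < q k)%R then ball x0 n.+1%:R `&`
  ([set x | (q k)%:E <= f x] `&` [set x | C%:E * emaximal f x <= (q k)%:E]) else set0.
have mE k n : measurable (E k n).
  rewrite /E; case: ifP => // _; apply: measurableI => //; apply: measurableI.
    rewrite -[X in measurable X]setTI; exact: emeasurable_fun_c_infty.
  rewrite -[X in measurable X]setTI; exact: emeasurable_fun_infty_c.
have E0 k n : mu (E k n) = 0.
  rewrite /E; case: ifP => [q0|_]; last exact: measure0.
  apply: (@emaximal_small_level_null f C (q k) n.+1%:R _ x0) => //.
    by have := mE k n; rewrite /E q0.
  by move=> x [_ []].
exists (\bigcup_k \bigcup_n E k n); split.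
- by apply: bigcup_measurable => k _; exact: bigcup_measurable.
- apply/eqP; rewrite eq_le measure_ge0 andbT.
  apply: le_trans (@generalized_Boole_inequality _ _ _ mu _ _ _) _.
  + by move=> k; exact: bigcup_measurable.
  + by apply: bigcup_measurable => k _; exact: bigcup_measurable.
  rewrite eseries0// => k _ _; apply/eqP; rewrite eq_le measure_ge0 andbT.
  apply: le_trans (@generalized_Boole_inequality _ _ _ mu _ _ _) _ => //.
    exact: bigcup_measurable.
  by rewrite eseries0.
move=> x /= /negP; rewrite -ltNge => Mf.
have M0 : 0 <= C%:E * emaximal f x by rewrite mule_ge0 ?emaximal_ge0// lee_fin ltW.
have Mfin : C%:E * emaximal f x \is a fin_num.
  by rewrite ge0_fin_numE//; apply: lt_le_trans Mf _; rewrite leey.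
have [t t1 t2] : exists2 t : R, (fine (C%:E * emaximal f x) < t)%R & t%:E <= f x.
  case: (f x) Mf (f0 x) => [r||] // Mf _.
    by exists r => //; rewrite -lte_fin fineK.
  by exists (fine (C%:E * emaximal f x) + 1)%R; rewrite ?ltrDl ?leey.
have [r /andP[r1 r2]] := rat_in_itvoo t1.
have q0 : (0 < (ratr r : R))%R by apply: le_lt_trans r1; exact: fine_ge0.
exists (pickle r) => //.
have [n _ hn] : exists2 n : nat, True & (mdist x0 x < n.+1%:R)%R.
  exists (Num.bound (mdist x0 x)) => //.
  apply: lt_trans (archi_boundP (mdist_ge0 _ _)) _; by rewrite ltr_nat.
exists n => //; rewrite /E /q pickleK /= q0; split; first by rewrite in_ball.
split => /=; first by apply: le_trans t2; rewrite lee_fin ltW.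
by rewrite -(fineK Mfin) lee_fin ltW.
Qed.
End maximal_operator.

(** * Dyadic layers of powers *)

Section dyadic_layers.
Context (R : realType).
Implicit Types (l T v dl : R).

Lemma powR_dyadicS l dl k : 0 <= l ->
  (2 ^+ k.+1 * l) `^ dl = 2 `^ dl * (2 ^+ k * l) `^ dl.
Proof. by move=> l0; rewrite exprS -mulrA powRM// mulr_ge0// exprn_ge0. Qed.

Lemma sum_dyadic_le l dl N : 0 <= l -> 1 <= dl ->
  \sum_(j < N) (2 ^+ j * l) `^ dl <= (2 ^+ N * l) `^ dl.
Proof.
move=> l0 dl1; elim: N => [|N IH]; first by rewrite big_ord0 powR_ge0.
rewrite big_ord_recr /= powR_dyadicS//; apply: le_trans (lerD IH (lexx _)) _.
rewrite -mulr2n -[leLHS]mulr_natl ler_wpM2r ?powR_ge0//.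
by rewrite -[leLHS]powRr1// ler_powR// ler1n.
Qed.

(** A geometric sum is dominated by its last term, here the largest dyadic
    multiple of l below T. *)
Lemma sum_dyadic_below_le l T dl N : 0 <= l -> 1 <= dl -> 0 <= T ->
  \sum_(j < N) (if 2 ^+ j * l <= T then (2 ^+ j * l) `^ dl else 0) <=
  2 * T `^ dl.
Proof.
move=> l0 dl1 T0; elim: N => [|N IH].
  by rewrite big_ord0 mulr_ge0 ?powR_ge0.
rewrite big_ord_recr /=; case: ifP => [NT|_]; last by rewrite addr0.
apply: (@le_trans _ _ (\sum_(j < N) (2 ^+ j * l) `^ dl + (2 ^+ N * l) `^ dl)).
  by rewrite lerD2r; apply: ler_sum => j _; case: ifP => // _; rewrite powR_ge0.
apply: le_trans (lerD (sum_dyadic_le N l0 dl1) (lexx _)) _.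
rewrite -mulr2n -[leLHS]mulr_natl ler_pM2l//.
by apply: ge0_ler_powR => //; rewrite ?nnegrE ?mulr_ge0 ?exprn_ge0// (le_trans _ dl1).
Qed.

Lemma sum_dyadic_telescope l dl N : 0 <= l ->
  l `^ dl + \sum_(j < N) (2 `^ dl - 1) * (2 ^+ j * l) `^ dl = (2 ^+ N * l) `^ dl.
Proof.
move=> l0; elim: N => [|N IH]; first by rewrite big_ord0 addr0 expr0 mul1r.
by rewrite big_ord_recr /= addrA IH powR_dyadicS//; ring.
Qed.

(** A discrete layer cake formula: the right-hand side telescopes up to the
    first dyadic level above v. *)
Lemma powR_layers_le l v dl N :
  0 <= l -> 0 <= dl -> 0 <= v -> v <= 2 ^+ N * l ->
  v `^ dl <= l `^ dl +
    \sum_(j < N) (2 `^ dl - 1) * (2 ^+ j * l) `^ dl * (2 ^+ j * l < v)%R%:R.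
Proof.
move=> l0 dl0 v0.
have k0 : 0 <= 2 `^ dl - 1 :> R.
  by rewrite subr_ge0 -[leLHS](powRr0 2) ler_powR// ler1n.
elim: N => [|N IH] vN.
  rewrite big_ord0 addr0 ge0_ler_powR// ?nnegrE//.
  by move: vN; rewrite expr0 mul1r.
have [vN'|Nv] := leP v (2 ^+ N * l).
  rewrite big_ord_recr /= addrA; apply: le_trans (IH vN') _.
  by rewrite lerDl !mulr_ge0// powR_ge0.
rewrite (eq_bigr (fun j : 'I_N.+1 => (2 `^ dl - 1) * (2 ^+ j * l) `^ dl)).
  rewrite sum_dyadic_telescope// ge0_ler_powR// ?nnegrE//.
  by rewrite mulr_ge0// exprn_ge0.
move=> j _; rewrite (_ : _ < v = true) ?mulr1//; apply: le_lt_trans Nv.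
by rewrite ler_wpM2r// ler_eXn2l// ?ltr1n// -ltnS.
Qed.
End dyadic_layers.

(** * Reverse Hoelder inequality for bounded A_1 functions *)

Section reverse_hoelder.
Context (R : realType) (d : measure_display) (X : metricMeasurableType R d).
Variables (mu : {measure set X -> \bar R}) (cmu : R).
Hypothesis H : doubling_metric_measure_space mu cmu.
Hypothesis c_ge1 : (1 <= cmu)%R.
Variables (V : X -> R) (K eta m : R).
Hypothesis K1 : (1 <= K)%R.
Hypothesis eta0 : (0 < eta)%R.
Hypothesis etaV : forall x, (eta <= V x)%R.
Hypothesis Vm : forall x, (V x <= m)%R.
Hypothesis Vlsc : forall a : R, open [set x | a < V x]%R.
Implicit Types (x y z : X).
Local Open Scope ereal_scope.
Hypothesis VA1 : forall z (r : R) x, (0 < r)%R -> ball z r x ->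
  \int[mu]_(y in ball z r) (V y)%:E <= (K * V x)%:E * mu (ball z r).

Let mopen := open_measurable_metric H.
Let mball := measurable_metric_ball H.
Let K0 : (0 <= K)%R := le_trans ler01 K1.
Let c0 : (0 <= cmu)%R := le_trans ler01 c_ge1.
Let V0 x : (0 < V x)%R := lt_le_trans eta0 (etaV x).

Lemma measurable_A1_function : measurable_fun [set: X] V.
Proof.
by apply/measurable_EFinP; apply: (measurable_open_superlevels H) => a; exact: Vlsc.
Qed.
Let mV := measurable_A1_function.

Let mEV D : measurable_fun D (EFin \o V).
Proof. by apply: measurable_funTS; apply/measurable_EFinP. Qed.

Let mle (a : R) : measurable [set x | a <= V x]%R.
Proof.
rewrite -[X in measurable X]setTI.
by apply: measurable_fun_le.
Qed.

Let mleK (a : R) : measurable [set x | a <= K * V x]%R.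
Proof.
rewrite -[X in measurable X]setTI.
by apply: measurable_fun_le => //; exact: measurable_funM.
Qed.

Lemma cst_le_integral_ball z (r lam : R) : (0 <= lam)%R ->
  (forall y, ball z r y -> lam <= V y)%R ->
  lam%:E * mu (ball z r) <= \int[mu]_(y in ball z r) (V y)%:E.
Proof.
move=> lam0 lamV; rewrite -integral_cst//; apply: ge0_le_integral => //.
Qed.

(** Lower semicontinuity gives some small ball on which the mean of V is at
    least lam; the largest dyadic such ball is taken. Its double has mean
    below lam unless the starting radius was already good, so it contains a
    point where V <= lam. *)
Lemma stopping_radius (lam r0 : R) y :
  (0 < r0)%R -> (0 < lam)%R -> (lam < V y)%R ->
  exists i, lam%:E * mu (ball y (r0 / 2 ^+ i)%R) <=
              \int[mu]_(t in ball y (r0 / 2 ^+ i)%R) (V t)%:E /\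
    (i = 0%N \/ exists2 z, ball y (2 * (r0 / 2 ^+ i))%R z & (V z <= lam)%R).
Proof.
move=> r00 lam0 lamV.
pose P i := lam%:E * mu (ball y (r0 / 2 ^+ i)%R) <=
              \int[mu]_(t in ball y (r0 / 2 ^+ i)%R) (V t)%:E.
have exP : exists i, P i.
  have [rho rho0 hrho] := open_ball_in (Vlsc lam) lamV.
  have [i hi] : exists i, (r0 / rho <= 2 ^+ i)%R.
    exists (Num.bound (r0 / rho)); apply/ltW.
    apply: lt_le_trans (archi_boundP _) _; first by rewrite divr_ge0// ltW.
    by rewrite -natrX ler_nat ltnW// ltn_expl.
  exists i; apply: cst_le_integral_ball => [|t yt]; first exact: ltW.
  apply/ltW; apply: hrho; apply: subset_ball_add yt.
  by rewrite mdistxx add0r ler_pdivrMr ?exprn_gt0// mulrC -ler_pdivrMr.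
have [i Pi imin] := find_ex_minn exP.
exists i; split => //.
case: i Pi imin => [|i] Pi imin; [by left|right].
apply: contrapT => nz.
suff /imin : P i by rewrite ltnn.
apply: cst_le_integral_ball => [|t yt]; first exact: ltW.
apply/ltW; rewrite ltNge; apply/negP => tlam; apply: nz.
exists t => //; apply: subset_ball_add yt.
by rewrite mdistxx add0r exprS invfM (mulrCA 2%R) (mulrA 2%R) divff// mul1r.
Qed.

(** A reverse weak type inequality. On a stopping ball the mean of V is at
    least lam, so K V >= lam there; its dilation contains a point where V <=
    lam, so by the A_1 condition the mean over the dilation is at most K lam.
    The covering estimate adds this up. *)
Lemma superlevel_integral_le x0 (r0 lam : R) x : (0 < r0)%R -> ball x0 r0 x ->
  (K * V x <= lam)%R ->
  \int[mu]_(y in ball x0 r0 `&` [set y | lam < V y]%R) (V y)%:E <=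
  (K * cmu ^+ 3 * lam)%:E *
    mu (ball x0 (2 * r0)%R `&` [set y | lam <= K * V y]%R).
Proof.
move=> r00 x0x Kx.
have lam0 : (0 < lam)%R by apply: lt_le_trans Kx; rewrite mulr_gt0// (lt_le_trans _ K1).
have xlam : (V x <= lam)%R by apply: le_trans Kx; rewrite ler_peMl// ltW.
have r20 : (0 < 2 * r0)%R by rewrite mulr_gt0.
set U := _ `&` [set y | lam <= K * V y]%R.
have mU : measurable U by exact: measurableI.
have /choice[s hs] : forall y, exists s : R, ball x0 r0 y -> (lam < V y)%R ->
    [/\ (0 < s <= r0)%R, lam%:E * mu (ball y s) <= \int[mu]_(t in ball y s) (V t)%:E &
      exists2 z, ball y (2 * s)%R z & (V z <= lam)%R].
  move=> y; have [lamV|] := ltP lam (V y); last by exists 0%R.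
  have [i [hi hz]] := stopping_radius r00 lam0 lamV.
  exists (r0 / 2 ^+ i)%R => x0y _; split => //.
    rewrite divr_gt0 ?exprn_gt0//= ler_pdivrMr ?exprn_gt0// ler_peMr ?(ltW r00)//.
    by rewrite exprn_ege1// ler1n.
  case: hz => [i0|//]; exists x => //; rewrite i0 expr0 divr1.
  move: x0x x0y; rewrite !in_ball => x0x x0y.
  apply: le_lt_trans (metric_triangle y x0 x) _.
  by rewrite (metric_sym y x0); lra.
apply: (@vitali_integral_le _ _ _ _ _ H _ _ s r0) => //.
- by apply: measurableI => //; apply: mopen; exact: Vlsc.
- apply: le_lt_trans (ball_measure_lty H x0 r20).
  by apply: le_measure; rewrite ?inE//; apply: subIsetl.
- by rewrite !mulr_ge0// ?exprn_ge0// ltW.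
- by move=> y; rewrite lee_fin ltW.
- move=> y [x0y /= lamVy]; have [s0r sP [z yz zlam]] := hs y x0y lamVy.
  have [s0 sr] := andP s0r.
  split => //.
    move=> t yt; split.
      apply: subset_ball_add yt; move: x0y; rewrite in_ball; lra.
    have := le_trans sP (VA1 s0 yt).
    rewrite -(fineK (ball_measure_fin H y s0)) -!EFinM lee_fin.
    by rewrite ler_pM2r// (ball_fine_gt0 H).
  have s8 : (0 < 2 ^+ 3 * s y)%R by rewrite mulr_gt0// exprn_gt0.
  have z8 : ball y (2 ^+ 3 * s y)%R z.
    by apply: subset_ball_add yz; rewrite mdistxx add0r ler_pM2r//; lra.
  apply: (@le_trans _ _ (\int[mu]_(x in ball y (2 ^+ 3 * s y)%R) (V x)%:E)).
    apply: ge0_subset_integral => //.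
    - by move=> t _; rewrite lee_fin ltW.
    - by apply: subset_ball_add; rewrite mdistxx add0r ler_pM2r//; lra.
  apply: le_trans (VA1 s8 z8) _.
  apply: (@le_trans _ _ ((K * lam)%:E * ((cmu ^+ 3)%:E * mu (ball y (s y))))).
    apply: lee_pmul => //.
    - by rewrite lee_fin mulr_ge0// ltW.
    - by rewrite lee_fin ler_wpM2l.
    - exact: doubling_iter.
  by rewrite muleA -EFinM mulrAC.
Qed.

Lemma powR_1D (a dl : R) : (0 < a)%R -> (a `^ (1 + dl) = a * a `^ dl)%R.
Proof. by move=> a0; rewrite powRD ?powRr1 ?ltW// (gt_eqF a0) implybT. Qed.

Lemma powR_1D_leM (a dl : R) : (0 <= dl <= 1)%R -> (0 < a)%R ->
  ((K * a) `^ (1 + dl) <= K ^+ 2 * a `^ (1 + dl))%R.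
Proof.
move=> /andP[dl0 dl1] a0; rewrite powRM ?(ltW a0)// ler_wpM2r ?powR_ge0//.
by rewrite -powR_mulrn// ler_powR//; lra.
Qed.

(** Decompose V^dl into dyadic layers starting at l = K V x, apply
    [superlevel_integral_le] on each, and sum again. Summation costs a factor
    2^dl - 1, which is small with dl; this smallness is the source of the
    whole self-improvement. *)
Lemma layered_integral_le x0 (r0 : R) x (dl : R) : (0 <= dl <= 1)%R ->
  (0 < r0)%R -> ball x0 r0 x ->
  \int[mu]_(y in ball x0 r0) (V y `^ (1 + dl))%:E <=
  (K ^+ 2 * V x `^ (1 + dl))%:E * mu (ball x0 r0) +
  ((2 `^ dl - 1) * (2 * K ^+ 3 * cmu ^+ 3))%:E *
    \int[mu]_(y in ball x0 (2 * r0)%R) (V y `^ (1 + dl))%:E.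
Proof.
move=> dl01 r00 x0x; have /andP[dl0 dl1] := dl01.
pose l := (K * V x)%R.
have l0 : (0 < l)%R by rewrite mulr_gt0// (lt_le_trans _ K1).
have [N hN] : exists N, (m <= 2 ^+ N * l)%R.
  exists (Num.bound (m / l)); rewrite -ler_pdivrMr//; apply/ltW.
  have m0 : (0 <= m)%R by apply: le_trans (Vm x); exact: ltW.
  apply: lt_le_trans (archi_boundP _) _; first by rewrite divr_ge0// ltW.
  by rewrite -natrX ler_nat ltnW// ltn_expl.
pose A (j : nat) := [set y | 2 ^+ j * l < V y]%R.
pose A' (j : nat) := [set y | 2 ^+ j * l <= K * V y]%R.
have mA j : measurable (A j) by apply: mopen; exact: Vlsc.
have mA' j : measurable (A' j) by exact: mleK.
pose kap : R := (2 `^ dl - 1)%R.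
have kap0 : (0 <= kap)%R by rewrite subr_ge0 -[leLHS](powRr0 2) ler_powR// ler1n.
have pl0 j : (0 <= (2 ^+ j * l) `^ dl)%R by exact: powR_ge0.
have mVp D : measurable_fun D (fun y => (V y `^ (1 + dl))%:E).
  apply: measurable_funTS; apply/measurable_EFinP.
  exact: (measurableT_comp (measurable_powR (1 + dl)%R) mV).
have mVA D j : measurable_fun D ((EFin \o V) \_ (A j)).
  by apply: measurable_funTS; apply/(measurable_restrictT _ (mA j)); exact: mEV.
have VA0 j y : 0 <= ((EFin \o V) \_ (A j)) y.
  by rewrite patchE; case: ifP => //= _; rewrite lee_fin ltW.
have split_layers : \int[mu]_(y in ball x0 r0) (V y `^ (1 + dl))%:E <=
    (l `^ dl)%:E * \int[mu]_(y in ball x0 r0) (V y)%:E +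
    \sum_(j < N) (kap * (2 ^+ j * l) `^ dl)%:E *
      \int[mu]_(y in ball x0 r0 `&` A j) (V y)%:E.
  have mc j : measurable_fun (ball x0 r0)
      (fun y => (kap * (2 ^+ j * l) `^ dl)%:E * ((EFin \o V) \_ (A j)) y).
    by apply: emeasurable_funM => //; exact: mVA.
  have c0' j y : 0 <= (kap * (2 ^+ j * l) `^ dl)%:E * ((EFin \o V) \_ (A j)) y.
    by rewrite mule_ge0// lee_fin mulr_ge0.
  under [X in _ <= _ + X]eq_bigr do rewrite integral_mkcondr
    -ge0_integralZl_EFin ?mulr_ge0//.
  rewrite -ge0_integral_sum// -ge0_integralZl_EFin ?powR_ge0//; last first.
    by move=> y _; rewrite lee_fin ltW.
  rewrite -ge0_integralD//.
  - apply: ge0_le_integral => //.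
    + by move=> y _; rewrite lee_fin powR_ge0.
    + apply: emeasurable_funD; last exact: emeasurable_sum.
      by apply: emeasurable_funM => //; exact: mEV.
    move=> y _.
    rewrite (eq_bigr (fun j : 'I_N => (kap * (2 ^+ j * l) `^ dl *
        (V y * (2 ^+ j * l < V y)%R%:R))%:E)).
      rewrite sumEFin -EFinM -EFinD lee_fin powR_1D//.
      have := powR_layers_le (ltW l0) dl0 (ltW (V0 y)) (le_trans (Vm y) hN).
      move=> /(ler_wpM2l (ltW (V0 y)))/le_trans; apply.
      rewrite mulrDr mulr_sumr; apply: lerD; first by rewrite mulrC.
      by apply: ler_sum => j _; rewrite mulrCA.
    move=> j _; rewrite [RHS]EFinM; congr (_ * _); rewrite patchE /=.
    rewrite /A; case: (ltP (2 ^+ j * l)%R (V y)) => h.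
      by rewrite mem_set// mulr1.
    by rewrite memNset ?mulr0//=; apply/negP; rewrite -leNgt.
  - by move=> y _; rewrite mule_ge0 ?lee_fin ?powR_ge0 ?ltW.
  - by apply: emeasurable_funM => //; exact: mEV.
  - by move=> y _; exact: sume_ge0.
  - exact: emeasurable_sum.
apply: le_trans split_layers _; apply: leeD.
  apply: (@le_trans _ _ ((l `^ dl)%:E * (l%:E * mu (ball x0 r0)))).
    by rewrite lee_wpmul2l ?lee_fin ?powR_ge0//; exact: VA1.
  rewrite muleA -EFinM lee_wpmul2r// lee_fin mulrC -powR_1D//.
  exact: powR_1D_leM.
apply: (@le_trans _ _ (\sum_(j < N) (kap * (K * cmu ^+ 3) * (2 ^+ j * l) `^ (1 + dl))%:E *
    \int[mu]_(y in ball x0 (2 * r0)%R) (\1_(A' j) y)%:E)).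
  apply: lee_sum => j _.
  have j0 : (0 < 2 ^+ j * l)%R by rewrite mulr_gt0// exprn_gt0.
  rewrite integral_indic// [A' j `&` _]setIC powR_1D//.
  have jl : (K * V x <= 2 ^+ j * l)%R.
    by rewrite -/l -[leLHS]mul1r ler_wpM2r ?(ltW l0)// exprn_ege1// ler1n.
  apply: (le_trans (lee_wpmul2l _ (superlevel_integral_le r00 x0x jl))).
    by rewrite lee_fin mulr_ge0.
  rewrite muleA -EFinM lee_wpmul2r// lee_fin le_eqVlt; apply/orP; left; apply/eqP.
  by ring.
have mI j : measurable_fun (ball x0 (2 * r0)%R) (fun y => (\1_(A' j) y : R)%:E).
  by apply: measurable_funTS; apply/measurable_EFinP.
have a0 j : (0 <= kap * (K * cmu ^+ 3) * (2 ^+ j * l) `^ (1 + dl))%R.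
  by rewrite !mulr_ge0 ?powR_ge0 ?exprn_ge0.
under eq_bigr do rewrite -ge0_integralZl_EFin//.
rewrite -ge0_integral_sum//; last 2 first.
- by move=> j; apply: emeasurable_funM => //.
- by move=> j y _; rewrite mule_ge0// lee_fin.
rewrite -ge0_integralZl_EFin//; last 2 first.
- by move=> y _; rewrite lee_fin powR_ge0.
- by rewrite !mulr_ge0 ?exprn_ge0.
apply: ge0_le_integral => //.
- by move=> y _; apply: sume_ge0 => j _; rewrite mule_ge0// lee_fin.
- by apply: emeasurable_sum => j; apply: emeasurable_funM.
- by apply: emeasurable_funM.
move=> y _; rewrite (eq_bigr (fun j : 'I_N => (kap * (K * cmu ^+ 3) *
    (if 2 ^+ j * l <= K * V y then (2 ^+ j * l) `^ (1 + dl) else 0))%:E)%R).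
  rewrite sumEFin -EFinM lee_fin -mulr_sumr.
  have KV0 : (0 <= K * V y)%R by rewrite mulr_ge0// ltW.
  have dl1' : (1 <= 1 + dl)%R by rewrite lerDl.
  have kk : (0 <= kap * (K * cmu ^+ 3))%R by rewrite !mulr_ge0// exprn_ge0.
  apply: le_trans (ler_wpM2l kk (sum_dyadic_below_le N (ltW l0) dl1' KV0)) _.
  have := ler_wpM2l kk (powR_1D_leM dl01 (V0 y)); rewrite -/kap; lra.
move=> j _; rewrite -EFinM; congr (_%:E); rewrite indicE /A'.
case: ifPn => h; first by rewrite mem_set// mulr1.
by rewrite memNset ?mulr0//=; apply/negP.
Qed.

(** The enlarged ball is harmless: x lies in it too, and the bound at x does
    not see the ball except through its measure. *)
Lemma reverse_hoelder_step (dl S : R) : (0 <= dl <= 1)%R -> (0 <= S)%R ->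
  (forall z (r : R) x, (0 < r)%R -> ball z r x ->
    \int[mu]_(y in ball z r) (V y `^ (1 + dl))%:E <=
      (S * V x `^ (1 + dl))%:E * mu (ball z r)) ->
  forall z (r : R) x, (0 < r)%R -> ball z r x ->
    \int[mu]_(y in ball z r) (V y `^ (1 + dl))%:E <=
      ((K ^+ 2 + (2 `^ dl - 1) * (2 * K ^+ 3 * cmu ^+ 4) * S) *
        V x `^ (1 + dl))%:E * mu (ball z r).
Proof.
move=> dl01 S0 hS z r x r0 zx; have /andP[dl0 dl1] := dl01.
apply: le_trans (layered_integral_le dl01 r0 zx) _.
have r20 : (0 < 2 * r)%R by rewrite mulr_gt0.
have zx2 : ball z (2 * r)%R x.
  by apply: subset_ball_add zx; rewrite mdistxx add0r; lra.
have kap0 : (0 <= 2 `^ dl - 1 :> R)%R.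
  by rewrite subr_ge0 -[leLHS](powRr0 2) ler_powR// ler1n.
have c1 : (0 <= (2 `^ dl - 1) * (2 * K ^+ 3 * cmu ^+ 3))%R.
  by rewrite !mulr_ge0// exprn_ge0.
have h := le_trans (hS _ _ _ r20 zx2)
  (lee_wpmul2l _ (dmms_doubling H z r0)).
have {}h := h _; rewrite ?lee_fin in h.
have {}h := h (mulr_ge0 S0 (powR_ge0 _ _)).
apply: le_trans (leeD (lexx _) (lee_wpmul2l _ h)) _; first by rewrite lee_fin.
rewrite -(fineK (ball_measure_fin H z r0)) -!EFinM -EFinD lee_fin.
by rewrite le_eqVlt; apply/orP; left; apply/eqP; ring.
Qed.

(** The bounds on V give the constant (m / eta)^(1 + dl) to start with; each
    step halves its distance to 2 K^2. *)
Lemma bounded_reverse_hoelder (dl : R) : (0 <= dl <= 1)%R ->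
  ((2 `^ dl - 1) * (2 * K ^+ 3 * cmu ^+ 4) <= 2^-1)%R ->
  forall z (r : R) x, (0 < r)%R -> ball z r x ->
    \int[mu]_(y in ball z r) (V y `^ (1 + dl))%:E <=
      (2 * K ^+ 2 * V x `^ (1 + dl))%:E * mu (ball z r).
Proof.
move=> dl01 hdl; have /andP[dl0 dl1] := dl01.
pose S0 : R := ((m / eta) `^ (1 + dl))%R.
have S00 : (0 <= S0)%R by exact: powR_ge0.
have iter (k : nat) z (r : R) x : (0 < r)%R -> ball z r x ->
    \int[mu]_(y in ball z r) (V y `^ (1 + dl))%:E <=
      ((2 * K ^+ 2 + S0 / 2 ^+ k) * V x `^ (1 + dl))%:E * mu (ball z r).
  elim: k z r x => [|k IH] z r x r0 zx.
    have m0 : (0 <= m)%R by apply: le_trans (Vm x); exact: ltW.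
    have mx : (m `^ (1 + dl) <= S0 * V x `^ (1 + dl))%R.
      rewrite /S0 -powRM ?divr_ge0// ?(ltW (V0 _))// ?(ltW eta0)//.
      apply: ge0_ler_powR; rewrite ?nnegrE ?addr_ge0 ?mulr_ge0 ?invr_ge0 ?(ltW (V0 _)) ?(ltW eta0)//.
      by rewrite mulrAC ler_pdivlMr// ler_wpM2l.
    apply: (@le_trans _ _ ((m `^ (1 + dl))%:E * mu (ball z r))).
      rewrite -integral_cst//; apply: ge0_le_integral => //.
      - by move=> y _; rewrite lee_fin powR_ge0.
      - apply: measurable_funTS; apply/measurable_EFinP.
        exact: (measurableT_comp (measurable_powR (1 + dl)%R) mV).
      - move=> y _; rewrite lee_fin ge0_ler_powR ?nnegrE ?addr_ge0//.
        exact: ltW.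
    rewrite lee_wpmul2r// lee_fin expr0 divr1; apply: le_trans mx _.
    by rewrite ler_wpM2r ?powR_ge0// lerDr mulr_ge0// exprn_ge0.
  have S0k : (0 <= 2 * K ^+ 2 + S0 / 2 ^+ k)%R.
    by rewrite addr_ge0 ?mulr_ge0 ?invr_ge0 ?exprn_ge0.
  apply: le_trans (reverse_hoelder_step dl01 S0k IH r0 zx) _.
  rewrite lee_wpmul2r// lee_fin ler_wpM2r ?powR_ge0//.
  (* K^2 + (2 K^2 + t) / 2 = 2 K^2 + t / 2 *)
  apply: (@le_trans _ _ (K ^+ 2 + 2^-1 * (2 * K ^+ 2 + S0 / 2 ^+ k)))%R.
    by rewrite lerD2l ler_wpM2r.
  rewrite (exprS 2%R k) invfM le_eqVlt; apply/orP; left; apply/eqP; field.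
  by rewrite expf_neq0.
move=> z r x r0 zx; apply/lee_addgt0Pr => e e0.
pose b := (V x `^ (1 + dl) * fine (mu (ball z r)))%R.
have b0 : (0 <= b)%R by rewrite mulr_ge0 ?powR_ge0// ltW// ball_fine_gt0.
have [k hk] : exists k, (S0 * b <= e * 2 ^+ k)%R.
  exists (Num.bound (S0 * b / e)); rewrite -ler_pdivrMl// mulrC; apply/ltW.
  apply: lt_le_trans (archi_boundP _) _; first by rewrite divr_ge0 ?(mulr_ge0 S00 b0) ?(ltW e0).
  by rewrite -natrX ler_nat ltnW// ltn_expl.
apply: le_trans (iter k z r x r0 zx) _.
rewrite -(fineK (ball_measure_fin H z r0)) -!EFinM -EFinD lee_fin.
rewrite -/b mulrDl [leLHS]mulrDl -!mulrA lerD2l mulrCA mulrC -/b.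
have : (S0 * b / 2 ^+ k <= e)%R by rewrite ler_pdivrMr ?exprn_gt0.
by apply: le_trans; rewrite /b le_eqVlt; apply/orP; left; apply/eqP; ring.
Qed.

End reverse_hoelder.

(** * Series of extended reals *)

Section series_lemmas.
Context (R : realType).
Local Open Scope ereal_scope.

Lemma nneseries_leP (u : (\bar R)^nat) (t : \bar R) : (forall n, 0 <= u n) ->
  (forall n, \sum_(0 <= k < n) u k <= t) -> \sum_(k <oo) u k <= t.
Proof.
move=> u0 ut; apply: lime_le; first by apply: is_cvg_nneseries.
by apply: nearW => n; exact: ut.
Qed.

Lemma nneseries_shift_le (u : (\bar R)^nat) : (forall n, 0 <= u n) ->
  \sum_(k <oo) u k.+1 <= \sum_(k <oo) u k.
Proof.
move=> u0; rewrite [leRHS]nneseries_recl// -(nneseries_addn 1)//.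
under [X in _ <= _ + X]eq_eseriesr do rewrite addn1.
by rewrite leeDr.
Qed.

Lemma sum_halves_le n : (\sum_(0 <= k < n) 2^-1 ^+ k <= 2 :> R)%R.
Proof.
have -> : (\sum_(0 <= k < n) 2^-1 ^+ k = 2 - 2 * 2^-1 ^+ n :> R)%R.
  elim: n => [|n IH]; first by rewrite big_nil expr0 mulr1 subrr.
  by rewrite big_nat_recr//= IH exprS; field.
by rewrite gerDl oppr_le0 mulr_ge0// exprn_ge0.
Qed.

(** As t may be infinite, the geometric sum is taken on partial sums only. *)
Lemma nneseries_halves_le (u : (\bar R)^nat) (t : \bar R) :
  (forall n, 0 <= u n) -> (forall n, u n <= (2^-1 ^+ n)%:E * t) ->
  \sum_(k <oo) u k <= 2%:E * t.
Proof.
move=> u0 ut; apply: nneseries_leP => // n.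
have t0 : 0 <= t by have := le_trans (u0 0%N) (ut 0%N); rewrite expr0 mul1e.
apply: (@le_trans _ _ (\sum_(0 <= k < n) (2^-1 ^+ k)%:E * t)).
  exact: lee_sum.
rewrite -ge0_sume_distrl; last by move=> i _; rewrite lee_fin exprn_ge0.
by rewrite lee_wpmul2r// sumEFin lee_fin sum_halves_le.
Qed.

(** For lower semicontinuity of a sum: a strict lower bound of the sum splits
    into strict lower bounds of the terms, infinite values included. *)
Lemma lte_add_split (a : R) (u v : \bar R) : 0 <= u -> 0 <= v -> a%:E < u + v ->
  exists b c : R, [/\ b%:E < u, c%:E < v & (a <= b + c)%R].
Proof.
case: u => [u| |]//; case: v => [v| |]// u0 v0.
- rewrite -EFinD lte_fin => auv.
  exists (u - (u + v - a) / 2)%R, (v - (u + v - a) / 2)%R; rewrite !lte_fin.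
  by split; lra.
- by exists (u - 1)%R, (a - u + 1)%R; rewrite ltry lte_fin; split => //; lra.
- by exists (a - v + 1)%R, (v - 1)%R; rewrite ltry lte_fin; split => //; lra.
- by exists a, 0%R; rewrite !ltry addr0.
Qed.

Lemma ge0_le_poweR (r : R) (x y : \bar R) : (0 <= r)%R -> 0 <= x -> x <= y ->
  x `^ r <= y `^ r.
Proof.
move=> r0 x0 xy; apply: gt0_ler_poweR => //; rewrite in_itv /= leey andbT//.
exact: le_trans xy.
Qed.

(** Each u_n is at most the p-th root of the sum of the p-th powers, and the
    geometric weights sum to 2. This replaces the triangle inequality in L^p.
    *)
Lemma poweR_series_le (u : (\bar R)^nat) (p : R) :
  (0 < p)%R -> (forall n, 0 <= u n) ->
  (\sum_(k <oo) (2^-1 ^+ k)%:E * u k) `^ p <=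
  (2 `^ p)%:E * \sum_(k <oo) u k `^ p.
Proof.
move=> p0 u0; set T := \sum_(k <oo) u k `^ p.
have T0 : 0 <= T by apply: nneseries_ge0 => n _ _; exact: poweR_ge0.
have uT n : u n <= T `^ p^-1.
  rewrite -[leLHS]poweRe1// -(@mulfV _ p) ?gt_eqF// poweRrM.
  apply: ge0_le_poweR; rewrite ?invr_ge0 ?(ltW p0) ?poweR_ge0//.
  apply: (@le_trans _ _ (\sum_(0 <= k < n.+1) u k `^ p)).
    by rewrite big_nat_recr//= leeDr// sume_ge0// => *; exact: poweR_ge0.
  by apply: nneseries_lim_ge => *; exact: poweR_ge0.
have -> : (2 `^ p)%:E * T = (2%:E * T `^ p^-1) `^ p.
  rewrite poweRM ?poweR_ge0// -poweRrM mulVf ?gt_eqF// poweRe1//.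
apply: ge0_le_poweR; first exact: ltW.
  by apply: nneseries_ge0 => n _ _; rewrite mule_ge0// lee_fin exprn_ge0.
apply: nneseries_halves_le => n; first by rewrite mule_ge0// lee_fin exprn_ge0.
by rewrite lee_wpmul2l// lee_fin exprn_ge0.
Qed.
End series_lemmas.

(** * Sums of lower semicontinuous functions *)

Section lower_semicontinuity.
Context (R : realType) (X : metricType R).
Implicit Types (f g : X -> \bar R).
Local Open Scope ereal_scope.

Lemma open_superlevelD f g : (forall x, 0 <= f x) -> (forall x, 0 <= g x) ->
  (forall a : R, open [set x | a%:E < f x]) ->
  (forall a : R, open [set x | a%:E < g x]) ->
  forall a : R, open [set x | a%:E < f x + g x].
Proof.
move=> f0 g0 of_ og a; apply: open_from_balls => x /= /(lte_add_split (f0 x) (g0 x)).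
move=> [b [c [bf cg abc]]].
have [||r r0 rU] := @open_ball_in _ _ ([set x | b%:E < f x] `&` [set x | c%:E < g x]) x.
- exact: openI.
- by split.
exists r => // y /rU[/= bfy cgy]; apply: (@le_lt_trans _ _ (b%:E + c%:E)).
  by rewrite -EFinD lee_fin.
exact: lteD.
Qed.

Lemma open_superlevel_series (F : (X -> \bar R)^nat) :
  (forall k x, 0 <= F k x) ->
  (forall k (a : R), open [set x | a%:E < F k x]) ->
  forall a : R, open [set x | a%:E < \sum_(k <oo) F k x].
Proof.
move=> F0 oF a.
rewrite (_ : [set x | _] = \bigcup_n [set x | a%:E < \sum_(0 <= k < n) F k x]).
  apply: bigcup_open => n _; elim: n a => [|n IH] a.
    under eq_set => x do rewrite big_nil.
    have [a0|a0] := ltP a%:E (0 : \bar R).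
      by rewrite (_ : [set x | _] = setT) ?eqEsubset//; exact: openT.
    rewrite (_ : [set x | _] = set0); first exact: open0.
    by apply/seteqP; split => // x.
  under eq_set => x do rewrite big_nat_recr//=.
  by apply: open_superlevelD => // x; exact: sume_ge0.
apply/seteqP; split => [x /= ax|x [n _] /= ax].
  apply: contrapT => nx; move: ax; rewrite ltNge => /negP; apply.
  apply: nneseries_leP => // n; rewrite leNgt; apply/negP => h.
  by apply: nx; exists n.
by apply: lt_le_trans ax _; apply: nneseries_lim_ge.
Qed.
End lower_semicontinuity.

(** * The Rubio de Francia iteration *)

Section rubio_de_francia_iteration.
Context (R : realType) (d : measure_display) (X : metricMeasurableType R d).
Variables (mu : {measure set X -> \bar R}) (cmu : R).
Hypothesis H : doubling_metric_measure_space mu cmu.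
Variables (w : X -> R) (A p : R).
Hypothesis A1 : (1 <= A)%R.
Hypothesis p1 : (1 <= p)%R.
Hypothesis mw : measurable_fun [set: X] w.
Hypothesis w0 : forall x, (0 <= w x)%R.
Implicit Types (x y z : X) (f : X -> \bar R).
Local Open Scope ereal_scope.
Local Notation M := (emaximal mu).

Let mopen := open_measurable_metric H.
Let mball := measurable_metric_ball H.

Hypothesis bounded_M : forall f, measurable_fun [set: X] f ->
  (forall x, 0 <= f x) ->
  \int[mu]_x (M f x `^ p * (w x)%:E) <= A%:E * \int[mu]_x (f x `^ p * (w x)%:E).

Definition iter_emaximal k f := iter k.+1 M f.

(** The iteration starts at k = 0 with M f and omits f itself, so that every
    term is lower semicontinuous. *)
Definition rubio_de_francia f x : \bar R :=
  \sum_(k <oo) (((4 * A)^-1 ^+ k)%:E * iter_emaximal k f x).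

Section fixed_function.
Variable f : X -> \bar R.
Hypothesis mf : measurable_fun [set: X] f.
Hypothesis f0 : forall x, 0 <= f x.

Let A0 : (0 < A)%R := lt_le_trans ltr01 A1.
Let e0 : (0 < (4 * A)^-1)%R.
Proof. by rewrite invr_gt0 mulr_gt0. Qed.

Lemma iter_emaximal_ge0 k x : 0 <= iter_emaximal k f x.
Proof. by elim: k x => [|k IH] x /=; exact: emaximal_ge0. Qed.

Lemma measurable_iter_emaximal k : measurable_fun [set: X] (iter_emaximal k f).
Proof. exact: (measurable_emaximal H). Qed.

Let term_ge0 k x : 0 <= ((4 * A)^-1 ^+ k)%:E * iter_emaximal k f x.
Proof. by rewrite mule_ge0 ?iter_emaximal_ge0// lee_fin exprn_ge0// ltW. Qed.

Lemma rubio_de_francia_ge0 x : 0 <= rubio_de_francia f x.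
Proof. exact: nneseries_ge0. Qed.

Lemma rubio_de_francia_open (a : R) :
  open [set x | a%:E < rubio_de_francia f x].
Proof.
apply: open_superlevel_series => // k {}a.
have ek : (0 < (4 * A)^-1 ^+ k)%R by exact: exprn_gt0.
rewrite (_ : [set x | _] = [set x | (a / (4 * A)^-1 ^+ k)%:E < iter_emaximal k f x]).
  exact: emaximal_open.
by apply/funext => x /=; rewrite EFinM lte_pdivrMr// [in RHS]muleC.
Qed.

Lemma measurable_rubio_de_francia :
  measurable_fun [set: X] (rubio_de_francia f).
Proof.
by apply: (measurable_open_superlevels H) => a; exact: rubio_de_francia_open.
Qed.

Lemma le_rubio_de_francia x : M f x <= rubio_de_francia f x.
Proof.
apply: (@le_trans _ _ (\sum_(0 <= k < 1) ((4 * A)^-1 ^+ k)%:E * iter_emaximal k f x)).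
  by rewrite big_nat1 expr0 mul1e.
exact: nneseries_lim_ge.
Qed.

(** The A_1 property. Averaging shifts the series by one index, which costs
    one factor of the ratio. *)
Lemma integral_ball_rubio_de_francia_le z (r : R) x : (0 < r)%R -> ball z r x ->
  \int[mu]_(y in ball z r) rubio_de_francia f y <=
    (4 * A)%:E * rubio_de_francia f x * mu (ball z r).
Proof.
move=> r0 zx; rewrite integral_nneseries//; last first.
  by move=> k; apply: measurable_funTS; apply: emeasurable_funM => //; exact: measurable_iter_emaximal.
have mfin := ball_measure_fin H z r0.
apply: (@le_trans _ _ (\sum_(k <oo) ((4 * A) * fine (mu (ball z r)))%:E *
    (((4 * A)^-1 ^+ k.+1)%:E * iter_emaximal k.+1 f x))).
  apply: lee_nneseries => [k _ _|k _]; first exact: integral_ge0.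
  rewrite ge0_integralZl_EFin//; last 3 first.
  - by move=> y _; exact: iter_emaximal_ge0.
  - by apply: measurable_funTS; exact: measurable_iter_emaximal.
  - by rewrite exprn_ge0// ltW.
  rewrite muleA -EFinM exprS (_ : (_ * _ * _)%R =
    ((4 * A)^-1 ^+ k * fine (mu (ball z r)))%R); last first.
    by field; rewrite gt_eqF.
  rewrite EFinM fineK// -muleA lee_wpmul2l ?lee_fin ?exprn_ge0 ?(ltW e0)//.
  rewrite muleC; exact: (integral_ball_le_emaximal H (iter_emaximal k f) r0 zx).
rewrite nneseriesZl//.
have tail := nneseries_shift_le (fun k => term_ge0 k x).
apply: (le_trans (lee_wpmul2l _ tail)).
  by rewrite lee_fin !mulr_ge0// ltW.
by rewrite -/(rubio_de_francia f x) EFinM fineK// muleAC.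
Qed.

Lemma integral_iter_emaximal_le k :
  \int[mu]_x (iter_emaximal k f x `^ p * (w x)%:E) <=
  (A ^+ k.+1)%:E * \int[mu]_x (f x `^ p * (w x)%:E).
Proof.
elim: k => [|k IH]; first by rewrite expr1; exact: bounded_M.
apply: (le_trans (bounded_M (measurable_iter_emaximal k) (iter_emaximal_ge0 k))).
by rewrite exprS EFinM -muleA lee_wpmul2l// lee_fin ltW.
Qed.

(** Of the weight (4A)^(-k), the factor 2^(-k) is spent in [poweR_series_le];
    the factor (2A)^(-k), whose p-th power is no larger, beats the growth
    A^(k+1) of the iterates and leaves A 2^(-k). *)
Lemma integral_rubio_de_francia_le :
  \int[mu]_x (rubio_de_francia f x `^ p * (w x)%:E) <=
  (2 `^ p * (2 * A))%:E * \int[mu]_x (f x `^ p * (w x)%:E).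
Proof.
have p0 : (0 < p)%R by exact: lt_le_trans p1.
pose u k x := ((2 * A)^-1 ^+ k)%:E * iter_emaximal k f x.
have u0 k x : 0 <= u k x.
  by rewrite mule_ge0 ?iter_emaximal_ge0// lee_fin exprn_ge0// invr_ge0 mulr_ge0// ltW.
have mpow g : measurable_fun [set: X] g ->
    measurable_fun [set: X] (fun x => g x `^ p * (w x)%:E).
  move=> mg; apply: emeasurable_funM; last exact/measurable_EFinP.
  exact: (measurableT_comp (measurable_poweR p) mg).
have mu_ k : measurable_fun [set: X] (u k).
  by apply: emeasurable_funM => //; exact: measurable_iter_emaximal.
have pw0 g x : 0 <= g x `^ p * (w x)%:E by rewrite mule_ge0 ?poweR_ge0// lee_fin.
apply: (@le_trans _ _ (\int[mu]_x ((2 `^ p)%:E * \sum_(k <oo) (u k x `^ p * (w x)%:E)))).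
  apply: ge0_le_integral => //.
  - by apply: mpow; exact: measurable_rubio_de_francia.
  - apply: emeasurable_funM => //.
    by apply: ge0_emeasurable_sum => // k _; exact: mpow.
  move=> x _.
  have -> : \sum_(k <oo) (u k x `^ p * (w x)%:E) = (\sum_(k <oo) u k x `^ p) * (w x)%:E.
    rewrite muleC -nneseriesZl; last by move=> *; exact: poweR_ge0.
    by apply: eq_eseriesr => k _; rewrite muleC.
  rewrite muleA lee_wpmul2r ?lee_fin//.
  have -> : rubio_de_francia f x = \sum_(k <oo) (2^-1 ^+ k)%:E * u k x.
    apply: eq_eseriesr => k _; rewrite /u muleA -EFinM -exprMn_comm; last exact: mulrC.
    by rewrite -invfM mulrA -natrM.
  exact: poweR_series_le.
rewrite ge0_integralZl_EFin ?powR_ge0//; last 2 first.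
- by move=> x _; apply: nneseries_ge0.
- by apply: ge0_emeasurable_sum => // k _; exact: mpow.
rewrite integral_nneseries//; last by move=> k; exact: mpow.
rewrite EFinM -muleA lee_wpmul2l ?lee_fin ?powR_ge0// EFinM -muleA.
apply: nneseries_halves_le => k; first exact: integral_ge0.
have b0 : (0 <= ((2 * A)^-1 ^+ k) `^ p)%R by exact: powR_ge0.
have bk : (((2 * A)^-1 ^+ k) `^ p <= (2 * A)^-1 ^+ k)%R.
  have a0 : (0 < (2 * A)^-1 ^+ k)%R by rewrite exprn_gt0// invr_gt0 mulr_gt0.
  apply: ge1r_powR => //; rewrite a0/=.
  rewrite exprn_ile1// ?invr_ge0 ?mulr_ge0 ?(ltW A0)// invf_le1 ?mulr_gt0//.
  by move: A1; lra.
under eq_integral => x _.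
  rewrite /u poweRM ?iter_emaximal_ge0//; last first.
    by rewrite lee_fin exprn_ge0// invr_ge0 mulr_ge0// ltW.
  rewrite -muleA poweR_EFin; over.
rewrite /= ge0_integralZl_EFin//; last by apply: mpow; exact: measurable_iter_emaximal.
apply: (le_trans (lee_wpmul2l _ (integral_iter_emaximal_le k))); first by rewrite lee_fin.
rewrite !muleA -!EFinM lee_wpmul2r//; first exact: integral_ge0.
rewrite lee_fin; apply: (le_trans (ler_wpM2r _ bk)); first by rewrite exprn_ge0// ltW.
rewrite exprS mulrCA mulrC ler_wpM2r ?(ltW A0)// -exprMn invfM -mulrA mulVf ?gt_eqF//.
by rewrite mulr1.
Qed.

End fixed_function.
End rubio_de_francia_iteration.

(** * From bounded test functions to all nonnegative functions *)

Section monotone_limits.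
Context d (T : measurableType d) (R : realType).
Variable mu : {measure set T -> \bar R}.
Local Open Scope ereal_scope.

(** A monotone convergence bound that asks for no limit: f only has to lie
    below every upper bound of the sequence. *)
Lemma integral_sup_le (D : set T) (F : (T -> \bar R)^nat)
  (f : T -> \bar R) (t : \bar R) :
  measurable D -> (forall n, measurable_fun D (F n)) ->
  (forall n x, 0 <= F n x) ->
  (forall x, {homo F ^~ x : m n / (m <= n)%N >-> m <= n}) ->
  measurable_fun D f -> (forall x, 0 <= f x) ->
  (forall x s, (forall n, F n x <= s) -> f x <= s) ->
  (forall n, \int[mu]_(x in D) F n x <= t) ->
  \int[mu]_(x in D) f x <= t.
Proof.
move=> mD mF F0 ndF mf f0 fF Ft.
apply: (@le_trans _ _ (\int[mu]_(x in D) limn (F ^~ x))).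
  apply: ge0_le_integral => //.
  - apply: emeasurable_fun_cvg mF _ => x _.
    exact: ereal_nondecreasing_is_cvgn.
  - move=> x _; apply: fF => n.
    rewrite (cvg_lim _ (ereal_nondecreasing_cvgn (ndF x)))//.
    by apply: ereal_sup_ubound; exists n.
rewrite monotone_convergence//.
apply: lime_le; last by apply: nearW => n; exact: Ft.
apply: ereal_nondecreasing_is_cvgn => m n mn; apply: ge0_le_integral => //.
by move=> x _; exact: ndF.
Qed.

End monotone_limits.

Section extension.
Context (R : realType) (d : measure_display) (X : metricMeasurableType R d).
Variables (mu : {measure set X -> \bar R}) (cmu : R).
Hypothesis H : doubling_metric_measure_space mu cmu.
Implicit Types (x y z : X).
Local Open Scope ereal_scope.
Local Notation M := (emaximal mu).
Let mball := measurable_metric_ball H.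

Lemma maximal_functionE (f : X -> R) x :
  maximal_function mu f x = M (fun y => `|f y|%:E) x.
Proof. by []. Qed.

Lemma le_emaximal (f g : X -> \bar R) x :
  measurable_fun [set: X] f -> measurable_fun [set: X] g ->
  (forall y, 0 <= f y) -> (forall y, f y <= g y) -> M f x <= M g x.
Proof.
move=> mf mg f0 fg; apply/(emaximal_leP H) => z r r0 zx.
apply: le_trans (integral_ball_le_emaximal H g r0 zx).
by apply: ge0_le_integral => //; exact: measurable_funTS.
Qed.

(** The cutoff is in value and in space, so that the result is an admissible
    test function. *)
Definition truncation (x0 : X) (f : X -> \bar R) (n : nat) (x : X) : R :=
  if x \in (ball x0 n.+1%:R : set X) then fine (mine (f x) n%:R%:E) else 0%R.

Section truncation_of.
Variables (x0 : X) (f : X -> \bar R).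
Hypothesis mf : measurable_fun [set: X] f.
Hypothesis f0 : forall x, 0 <= f x.
Local Notation t := (truncation x0 f).

Let minfin n x : mine (f x) n%:R%:E \is a fin_num.
Proof.
have ge0 : 0 <= mine (f x) n%:R%:E by rewrite le_min f0 lee_fin ler0n.
by rewrite ge0_fin_numE// gt_min ltry orbT.
Qed.

Lemma truncation_ge0 n x : (0 <= t n x)%R.
Proof.
rewrite /truncation; case: ifP => // _; apply: fine_ge0.
by rewrite le_min f0 lee_fin ler0n.
Qed.

Lemma truncation_le_nat n x : (t n x <= n%:R)%R.
Proof.
rewrite /truncation; case: ifP => // _.
by rewrite -lee_fin fineK// ge_min lexx orbT.
Qed.

Lemma truncation_le n x : (t n x)%:E <= f x.
Proof.
rewrite /truncation; case: ifP => // _.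
by rewrite fineK// ge_min lexx.
Qed.

Lemma truncation_nd x :
  {homo (fun n => (t n x)%:E) : m n / (m <= n)%N >-> m <= n}.
Proof.
move=> m n mn; rewrite /truncation; case: ifPn => [xm|_].
  rewrite ifT; last first.
    move: xm; rewrite !inE; apply: subset_ball_add.
    by rewrite mdistxx add0r ler_nat.
  rewrite !fineK// le_min !ge_min lexx/=; apply/orP; right.
  by rewrite lee_fin ler_nat.
by rewrite lee_fin; exact: truncation_ge0.
Qed.

Lemma measurable_truncation n : measurable_fun [set: X] (t n).
Proof.
apply/measurable_EFinP.
rewrite (_ : _ \o _ = (fun x => mine (f x) n%:R%:E) \_ (ball x0 n.+1%:R)).
  apply/(measurable_restrictT (fun x => mine (f x) n%:R%:E) (mball x0 _)).
  by apply: measurable_funTS; exact: measurable_mine.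
apply/funext => x; rewrite /= patchE /truncation.
by case: ifP => // _; rewrite fineK.
Qed.

Lemma truncation_sup x (s : \bar R) : (forall n, (t n x)%:E <= s) -> f x <= s.
Proof.
move=> ts.
have s0 : 0 <= s by apply: le_trans (ts 0%N); rewrite lee_fin truncation_ge0.
have near_big (a : R) : exists n, (a <= n%:R)%R /\ x \in (ball x0 n.+1%:R : set X).
  exists (maxn (Num.bound `|a|) (Num.bound (mdist x0 x))); split.
    apply: le_trans (ler_norm a) _; apply/ltW.
    apply: lt_le_trans (archi_boundP (normr_ge0 _)) _.
    by rewrite ler_nat leq_maxl.
  rewrite inE in_ball; apply: lt_le_trans (archi_boundP (mdist_ge0 _ _)) _.
  by rewrite ler_nat leqW// leq_maxr.
case fx : (f x) (f0 x) => [a| |]// _.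
  have [n [an xn]] := near_big a.
  have := ts n; rewrite /truncation xn fx; suff -> : mine a%:E n%:R%:E = a%:E by [].
  by apply/min_idPl; rewrite lee_fin.
case: s s0 ts => [s| |]// _ ts.
have [n [an xn]] := near_big (s + 1)%R.
have := ts n; rewrite /truncation xn fx /= lee_fin.
by move=> /(le_trans an); rewrite gerDl ler10.
Qed.

Lemma truncation_Lfun n : t n \in Lfun mu +oo.
Proof.
rewrite inE; apply/andP; split; first by rewrite inE; exact: measurable_truncation.
rewrite inE /= /finite_norm unlock; case: ifP => // _.
apply: (@le_lt_trans _ _ n%:R%:E); last exact: ltry.
apply/ess_supP; apply: nearW => x /=.
by rewrite lee_fin ger0_norm ?truncation_ge0 ?truncation_le_nat.
Qed.

Lemma truncation_bounded_support n : bounded_support (t n).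
Proof.
exists x0, n.+1%:R; split => // x /=.
by rewrite /truncation; case: ifPn => [|_]; rewrite ?inE// eqxx.
Qed.

Lemma emaximal_truncation_sup x (s : \bar R) :
  (forall n, M (fun y => (t n y)%:E) x <= s) -> M f x <= s.
Proof.
move=> ts; apply/(emaximal_leP H) => z r r0 zx.
apply: (@integral_sup_le _ _ _ mu _ (fun n y => (t n y)%:E)) => //.
- by move=> n; apply: measurable_funTS; apply/measurable_EFinP; exact: measurable_truncation.
- by move=> n y; rewrite lee_fin truncation_ge0.
- exact: truncation_nd.
- exact: measurable_funTS.
- exact: truncation_sup.
- by move=> n; move: (z) (r) r0 zx; apply/(emaximal_leP H); exact: ts.
Qed.
End truncation_of.

Variables (w : X -> R) (p C1 : R).
Hypothesis p0 : (0 < p)%R.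
Hypothesis mw : measurable_fun [set: X] w.
Hypothesis wpos : {ae mu, forall x, (0 < w x)%R}.
Local Notation w' := (fun x => Num.max (w x) 0%R).
Hypothesis hyp : forall f : X -> R, (forall x, 0 <= f x)%R -> f \in Lfun mu +oo ->
      bounded_support f ->
      \int[mu]_x (maximal_function mu f x `^ p * (w x)%:E)
        <= C1%:E * \int[mu]_x (f x `^ p * w x)%:E.

(** The weight is positive only almost everywhere; its positive part makes the
    integrands nonnegative everywhere. *)
Lemma integral_weight_pos (h : X -> \bar R) : measurable_fun [set: X] h ->
  \int[mu]_x (h x * (w x)%:E) = \int[mu]_x (h x * (w' x)%:E).
Proof.
move=> mh; apply: ae_eq_integral => //.
- by apply: emeasurable_funM => //; exact/measurable_EFinP.
- apply: emeasurable_funM => //; apply/measurable_EFinP.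
  exact: measurable_maxr.
apply: filterS wpos => x wx _.
by rewrite max_l// ltW.
Qed.

(** Averages, and hence the maximal function, pass to increasing limits of the
    argument. *)
Lemma strong_type_ereal (f : X -> \bar R) (x0 : X) :
  measurable_fun [set: X] f ->
  (forall x, 0 <= f x) ->
  \int[mu]_x (M f x `^ p * (w' x)%:E) <=
    (Num.max C1 1)%:E * \int[mu]_x (f x `^ p * (w' x)%:E).
Proof.
move=> mf f0; pose t n y := (truncation x0 f n y)%:E.
have mt n : measurable_fun [set: X] (t n).
  by apply/measurable_EFinP; exact: measurable_truncation.
have t0 n y : 0 <= t n y by rewrite lee_fin truncation_ge0.
have mw' : measurable_fun [set: X] (EFin \o w').
  by apply/measurable_EFinP; exact: measurable_maxr.
have w'0 x : (0 <= w' x)%R by rewrite le_max lexx orbT.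
have mpow g : measurable_fun [set: X] g ->
    measurable_fun [set: X] (fun x => g x `^ p * (w' x)%:E).
  move=> mg; apply: emeasurable_funM => //.
  exact: (measurableT_comp (measurable_poweR p) mg).
have pw0 g x : 0 <= g x `^ p * (w' x)%:E by rewrite mule_ge0 ?poweR_ge0// lee_fin.
have powle (g h : X -> \bar R) x : 0 <= g x -> g x <= h x ->
    g x `^ p * (w' x)%:E <= h x `^ p * (w' x)%:E.
  move=> g0 gh; rewrite lee_wpmul2r ?lee_fin//.
  by apply: ge0_le_poweR => //; exact: ltW.
apply: (@integral_sup_le _ _ _ mu _ (fun n x => M (t n) x `^ p * (w' x)%:E)) => //.
- by move=> n; apply: mpow; exact: (measurable_emaximal H).
- move=> x m n mn; apply: powle; first exact: emaximal_ge0.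
  by apply: le_emaximal => // y; exact: truncation_nd.
- by apply: mpow; exact: (measurable_emaximal H).
- move=> x s ts; have [wx|wx] := eqVneq (w' x) 0%R.
    by have := ts 0%N; rewrite wx !mule0.
  have wx0 : (0 < w' x)%R by rewrite lt_neqAle eq_sym wx/=.
  have s0 : 0 <= s by exact: le_trans (ts 0%N).
  have sw0 : 0 <= s * (w' x)^-1%:E by rewrite mule_ge0// lee_fin invr_ge0.
  (* moving the power to the right avoids continuity of t |-> t^p *)
  rewrite -lee_pdivlMr//.
  rewrite -[leRHS]poweRe1// -(@mulVf _ p) ?gt_eqF// poweRrM.
  apply: ge0_le_poweR; [exact: ltW|exact: emaximal_ge0|].
  apply: (@emaximal_truncation_sup x0) => // n.
  have Mt0 : 0 <= M (t n) x by exact: emaximal_ge0.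
  rewrite -[leLHS]poweRe1// -(@mulfV _ p) ?gt_eqF// poweRrM.
  apply: ge0_le_poweR; rewrite ?invr_ge0 ?(ltW p0) ?poweR_ge0//.
  by rewrite lee_pdivlMr//; exact: ts.
- move=> n.
  have absE : (fun y => `|truncation x0 f n y|%:E) = t n.
    by apply/funext => y; rewrite ger0_norm ?truncation_ge0.
  have h : \int[mu]_x (M (t n) x `^ p * (w x)%:E) <=
      C1%:E * \int[mu]_x (t n x `^ p * (w x)%:E).
    have -> : M (t n) = maximal_function mu (truncation x0 f n) by rewrite -absE.
    exact: hyp (truncation_ge0 x0 f0 n) (truncation_Lfun x0 mf f0 n)
      (truncation_bounded_support x0 f n).
  move: h; rewrite integral_weight_pos; last first.
    apply: (measurableT_comp (measurable_poweR p)).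
    exact: (measurable_emaximal H).
  rewrite integral_weight_pos; last first.
    exact: (measurableT_comp (measurable_poweR p)).
  move/le_trans; apply.
  apply: (@le_trans _ _ ((Num.max C1 1)%:E * \int[mu]_x (t n x `^ p * (w' x)%:E))).
    rewrite lee_wpmul2r//; first by apply: integral_ge0 => x _; exact: (pw0 (t n)).
    by rewrite lee_fin le_max lexx.
  rewrite lee_wpmul2l ?lee_fin ?le_max ?ler01 ?orbT//.
  apply: ge0_le_integral => //; [exact: mpow|exact: mpow|].
  by move=> x _; apply: powle => //; exact: truncation_le.
Qed.
End extension.

(** * Reverse Hoelder inequality under an A_1 majorant *)

Section dominated_reverse_hoelder.
Context (R : realType) (d : measure_display) (X : metricMeasurableType R d).
Variables (mu : {measure set X -> \bar R}) (cmu : R).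
Hypothesis H : doubling_metric_measure_space mu cmu.
Hypothesis c_ge1 : (1 <= cmu)%R.
Variables (v : X -> \bar R) (K : R).
Hypothesis K1 : (1 <= K)%R.
Implicit Types (x y z : X).
Local Open Scope ereal_scope.
Hypothesis v0 : forall x, 0 <= v x.
Hypothesis vlsc : forall a : R, open [set x | a%:E < v x].
Hypothesis vA1 : forall z (r : R) x, (0 < r)%R -> ball z r x ->
  \int[mu]_(y in ball z r) v y <= K%:E * v x * mu (ball z r).
Variable dl : R.
Hypothesis dl01 : (0 <= dl <= 1)%R.
Hypothesis hdl : ((2 `^ dl - 1) * (2 * K ^+ 3 * cmu ^+ 4) <= 2^-1)%R.

Let mball := measurable_metric_ball H.
Let K0 : (0 <= K)%R := le_trans ler01 K1.
Let dl1 : (0 <= 1 + dl)%R.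
Proof. by have /andP[dl0 _] := dl01; rewrite addr_ge0. Qed.
Let mv : measurable_fun [set: X] v.
Proof. exact: (measurable_open_superlevels H). Qed.

(** Brings v between eta and m, preserving lower semicontinuity and, as K >=
    1, the A_1 constant. *)
Definition clamp (eta m : R) x : R := fine (mine (v x + eta%:E) m%:E).

Section clamp_lemmas.
Variables eta m : R.
Hypothesis eta0 : (0 < eta)%R.
Hypothesis eta_m : (eta <= m)%R.
Local Notation V := (clamp eta m).

Lemma clampE x : (V x)%:E = mine (v x + eta%:E) m%:E.
Proof.
rewrite /clamp fineK// ge0_fin_numE.
  by rewrite gt_min ltry orbT.
by rewrite le_min adde_ge0// ?lee_fin ?(ltW eta0)// (le_trans _ eta_m)// ltW.
Qed.

Lemma clamp_ge x : (eta <= V x)%R.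
Proof. by rewrite -lee_fin clampE le_min leeDr// lee_fin. Qed.

Lemma clamp_le x : (V x <= m)%R.
Proof. by rewrite -lee_fin clampE ge_min lexx orbT. Qed.

Lemma clamp_open (a : R) : open [set x | a < V x]%R.
Proof.
have [am|ma] := ltP a m.
  rewrite (_ : [set x | _] = [set x | (a - eta)%:E < v x]); first exact: vlsc.
  apply/funext => x /=.
  by rewrite -lte_fin clampE lt_min lte_fin am andbT EFinB lteBlDr.
rewrite (_ : [set x | _] = set0); first exact: open0.
apply/seteqP; split => // x /=; rewrite ltNge => /negP; apply.
exact: le_trans (clamp_le x) ma.
Qed.

Lemma clamp_A1 z (r : R) x : (0 < r)%R -> ball z r x ->
  \int[mu]_(y in ball z r) (V y)%:E <= (K * V x)%:E * mu (ball z r).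
Proof.
move=> r0 zx.
have mV D : measurable_fun D (fun y => (V y)%:E).
  apply: measurable_funTS; apply/measurable_EFinP.
  by apply: (measurable_A1_function H) => a; exact: clamp_open.
have V0 y : 0 <= (V y)%:E by rewrite lee_fin (le_trans _ (clamp_ge y))// ltW.
have e0 : 0 <= eta%:E by rewrite lee_fin ltW.
have m0 : (0 <= m)%R by apply: le_trans eta_m; exact: ltW.
rewrite EFinM clampE /mine; case: ifPn => _.
  apply: (@le_trans _ _ (\int[mu]_(y in ball z r) (v y + eta%:E))).
    apply: ge0_le_integral => //.
    - by apply: measurable_funTS; apply: emeasurable_funD.
    - by move=> y _; rewrite clampE ge_min lexx.
  rewrite ge0_integralD//; last exact: measurable_funTS.
  rewrite integral_cst//.
  apply: (le_trans (leeD (vA1 r0 zx) (lexx _))).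
  rewrite ge0_muleDr// ge0_muleDl ?mule_ge0 ?lee_fin//.
  rewrite leeD2l// lee_wpmul2r// -EFinM lee_fin ler_peMl// ltW.
apply: (@le_trans _ _ (m%:E * mu (ball z r))).
  rewrite -integral_cst//; apply: ge0_le_integral => // y _.
  by rewrite lee_fin clamp_le.
by rewrite lee_wpmul2r// -EFinM lee_fin ler_peMl.
Qed.
End clamp_lemmas.

Variables (F : X -> R) (C2 : R).
Hypothesis mF : measurable_fun [set: X] F.
Hypothesis F0 : forall x, (0 <= F x)%R.
Hypothesis C21 : (1 <= C2)%R.
Hypothesis Fv : {ae mu, forall x, (F x)%:E <= C2%:E * v x}.

Let C20 : (0 <= C2)%R := le_trans ler01 C21.

Let mpow (g : X -> R) D : measurable_fun [set: X] g ->
  measurable_fun D (fun y => (g y `^ (1 + dl))%:E).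
Proof.
move=> mg; apply: measurable_funTS; apply/measurable_EFinP.
exact: (measurableT_comp (measurable_powR (1 + dl)%R) mg).
Qed.

(** Apply [bounded_reverse_hoelder] to the clamped majorant. Cutting F at
    height n keeps it below C2 times the clamped v; then let n grow. *)
Lemma integral_pow_le_shifted z (r : R) x (b eta : R) :
  (0 < r)%R -> ball z r x ->
  v x = b%:E -> (0 < eta)%R ->
  \int[mu]_(y in ball z r) (F y `^ (1 + dl))%:E <=
  (C2 `^ (1 + dl) * (2 * K ^+ 2) * (b + eta) `^ (1 + dl))%:E * mu (ball z r).
Proof.
move=> r0 zx vxb eta0.
pose Fn n y := Num.min (F y) n%:R.
have mFn n : measurable_fun [set: X] (Fn n) by exact: measurable_minr.
have Fn0 n y : (0 <= Fn n y)%R by rewrite le_min F0 ler0n.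
apply: (@integral_sup_le _ _ _ mu _ (fun n y => (Fn n y `^ (1 + dl))%:E)) => //.
- by move=> n; exact: mpow.
- by move=> n y; rewrite lee_fin powR_ge0.
- move=> y k n kn; rewrite lee_fin ge0_ler_powR ?nnegrE//.
  by rewrite le_min !ge_min lexx/= ler_nat kn orbT.
- exact: mpow.
- by move=> y; rewrite lee_fin powR_ge0.
- move=> y s ts; have := ts (Num.bound (F y)).
  rewrite /Fn (_ : Num.min _ _ = F y)//; apply/min_idPl; apply/ltW.
  exact: archi_boundP.
move=> n; pose m := (n%:R + eta)%R.
have eta_m : (eta <= m)%R by rewrite lerDr.
pose V := clamp eta m.
have V0 y : (0 <= V y)%R by apply: le_trans (clamp_ge eta0 eta_m y); exact: ltW.
have mV : measurable_fun [set: X] V.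
  by apply: (measurable_A1_function H) => a; exact: clamp_open.
apply: (@le_trans _ _ (\int[mu]_(y in ball z r)
    ((C2 `^ (1 + dl))%:E * (V y `^ (1 + dl))%:E))).
  apply: ae_ge0_le_integral => //.
  - by move=> y _; rewrite lee_fin powR_ge0.
  - exact: mpow.
  - by move=> y _; rewrite -EFinM lee_fin mulr_ge0 ?powR_ge0.
  - by apply: emeasurable_funM => //; exact: mpow.
  apply: filterS Fv => y Fvy _; rewrite -EFinM lee_fin -powRM//.
  apply: ge0_ler_powR; rewrite ?nnegrE ?mulr_ge0//.
  rewrite -lee_fin EFinM clampE// /mine; case: ifPn => _.
    apply: (@le_trans _ _ (F y)%:E); first by rewrite lee_fin ge_min lexx.
    apply: le_trans Fvy _; rewrite lee_wpmul2l ?lee_fin// leeDl// lee_fin ltW//.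
  rewrite -EFinM lee_fin; apply: (@le_trans _ _ n%:R).
    by rewrite ge_min lexx orbT.
  apply: (@le_trans _ _ m); first by rewrite lerDl ltW.
  by rewrite ler_peMl// (le_trans _ eta_m)// ltW.
rewrite ge0_integralZl_EFin ?powR_ge0//; last 2 first.
- by move=> y _; rewrite lee_fin powR_ge0.
- exact: mpow.
have := bounded_reverse_hoelder H c_ge1 K1 eta0 (clamp_ge eta0 eta_m)
  (clamp_le eta0 eta_m) (clamp_open eta0 eta_m) (clamp_A1 eta0 eta_m) dl01 hdl r0 zx.
move=> h; apply: (le_trans (lee_wpmul2l _ h)); first by rewrite lee_fin powR_ge0.
rewrite muleA -EFinM lee_wpmul2r// lee_fin [leLHS]mulrA.
rewrite ler_wpM2l ?mulr_ge0 ?powR_ge0 ?exprn_ge0//.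
have b0 : (0 <= b)%R by rewrite -lee_fin -vxb.
have Vx0 : (0 <= clamp eta m x)%R := V0 x.
apply: ge0_ler_powR; rewrite ?nnegrE ?(addr_ge0 b0 (ltW eta0))//.
by rewrite -lee_fin clampE// vxb ge_min lexx.
Qed.

(** The shift by eta is removed by taking eta = v x when v x is positive, and
    by letting eta tend to 0 otherwise. *)
Lemma dominated_reverse_hoelder z (r : R) x : (0 < r)%R -> ball z r x ->
  \int[mu]_(y in ball z r) (F y `^ (1 + dl))%:E <=
  (C2 `^ (1 + dl) * (8 * K ^+ 2))%:E * v x `^ (1 + dl) * mu (ball z r).
Proof.
move=> r0 zx.
have dl0 : (0 < 1 + dl)%R by have /andP[? _] := dl01; rewrite ltr_pwDl.
have mfin := ball_measure_fin H z r0.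
have mpos := ball_fine_gt0 H z r0.
have C0 : (0 < C2 `^ (1 + dl) * (8 * K ^+ 2))%R.
  rewrite mulr_gt0 ?powR_gt0 ?(lt_le_trans _ C21)//.
  by rewrite mulr_gt0 ?exprn_gt0 ?(lt_le_trans _ K1).
case vx : (v x) (v0 x) => [b| |]// b0; last first.
  rewrite poweRyr ?gt_eqF// gt0_muley ?lte_fin// gt0_mulye ?leey//.
  exact: (ball_measure_gt0 H).
rewrite lee_fin in b0; rewrite poweR_EFin -EFinM.
have [b_gt0|] := ltP 0%R b.
  apply: (le_trans (integral_pow_le_shifted r0 zx vx b_gt0)).
  rewrite lee_wpmul2r// lee_fin -!mulrA ler_wpM2l ?powR_ge0//.
  have -> : (b + b = 2 * b)%R by ring.
  rewrite powRM//.
  have h2 : (2 `^ (1 + dl) <= 4 :> R)%R.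
    apply: (@le_trans _ _ (2 `^ 2)%R); last by rewrite powR_mulrn//; lra.
    by rewrite ler_powR ?ler1n//; have /andP[_ ?] := dl01; lra.
  have k0 : (0 <= K ^+ 2 * b `^ (1 + dl))%R by rewrite mulr_ge0 ?powR_ge0 ?exprn_ge0.
  by have := ler_wpM2r k0 h2; lra.
move=> b_le0; have bE : b = 0%R by apply/eqP; rewrite eq_le b_le0.
apply/lee_addgt0Pr => e e0.
rewrite bE powR0 ?gt_eqF// mulr0 mul0e add0e.
pose C := (C2 `^ (1 + dl) * (2 * K ^+ 2) * fine (mu (ball z r)))%R.
have Cpos : (0 <= C)%R by rewrite !mulr_ge0 ?powR_ge0 ?exprn_ge0 ?(ltW mpos).
pose eta := (Num.min 1 (e / (C + 1)))%R.
have eta0 : (0 < eta)%R by rewrite lt_min ltr01 divr_gt0// ltr_wpDl.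
apply: (le_trans (integral_pow_le_shifted r0 zx vx eta0)).
rewrite -(fineK mfin) -EFinM lee_fin bE add0r.
have eta_pow : (eta `^ (1 + dl) <= eta)%R.
  apply: ge1r_powR; first by rewrite eta0 ge_min lexx.
  by have /andP[? _] := dl01; rewrite lerDl.
have eta_e : (eta * (C + 1) <= e)%R.
  by rewrite -ler_pdivlMr ?ltr_wpDl// ge_min lexx orbT.
rewrite (_ : (_ * _ * _ * _)%R = (C * eta `^ (1 + dl))%R); last by rewrite /C; ring.
apply: (le_trans (ler_wpM2l Cpos eta_pow)).
by move: eta_e eta0; lra.
Qed.

End dominated_reverse_hoelder.

(** * The self-improvement *)

(** With dl = log_2 (1 + th) the factor 2^dl - 1 is exactly th. *)
Lemma exists_small_exponent (R : realType) (Q t : R) : 0 < Q -> 0 < t ->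
  exists dl : R, [/\ 0 < dl, dl <= 1, dl < t & (2 `^ dl - 1) * Q <= 2^-1].
Proof.
move=> Q0 t0.
pose th : R := Num.min (2 * Q)^-1 (Num.min 2^-1 (t / 4)).
have th0 : 0 < th by rewrite !lt_min invr_gt0 mulr_gt0// invr_gt0 ltr0n/= divr_gt0.
have thQ : th <= (2 * Q)^-1 by rewrite ge_min lexx.
have th2 : th <= 2^-1 by rewrite !ge_min lexx !orbT.
have tht : th <= t / 4 by rewrite !ge_min lexx !orbT.
(* ln (1/2) = ln (1 - 1/2) <= - 1/2 *)
have ln2 : (2^-1 : R) <= ln 2.
  have := @le_ln1Dx R (- 2^-1).
  have -> : 1 + - 2^-1 = 2^-1 :> R by field.
  rewrite lnV ?posrE// lerN2; apply.
  by rewrite ltrN2 invf_lt1 ?ltr1n.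
have ln2_gt0 : (0 : R) < ln 2 by apply: lt_le_trans ln2; rewrite invr_gt0.
have lnth : ln (1 + th) <= th by apply: le_ln1Dx; lra.
have lnth0 : 0 < ln (1 + th) by rewrite ln_gt0// ltrDl.
pose dl := ln (1 + th) / ln 2.
have dl_le : dl <= 2 * th by rewrite /dl ler_pdivrMr//; nra.
exists dl; split.
- by rewrite divr_gt0.
- by apply: le_trans dl_le _; lra.
- by apply: le_lt_trans dl_le _; lra.
have -> : 2 `^ dl = 1 + th.
  rewrite /powR gt_eqF// /dl divfK ?gt_eqF// lnK// posrE; lra.
rewrite addrAC subrr add0r.
by apply: le_trans (ler_wpM2r (ltW Q0) thQ) _; rewrite invfM -mulrA mulVf ?gt_eqF// mulr1.
Qed.

Theorem corollary5p13 (R : realType) (cmu p C1 : R) (hcmu : 1 < cmu)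
    (hp : 1 < p) :
  exists eps C : R, [/\ 0 < eps, eps < p - 1 &
    forall (d : measure_display) (X : metricMeasurableType R d)
      (mu : {measure set X -> \bar R}) (w : X -> R),
    doubling_metric_measure_space mu cmu ->
    is_weight mu w ->
    (forall f : X -> R, (forall x, 0 <= f x) -> f \in Lfun mu +oo%E ->
      bounded_support f ->
      (\int[mu]_x (maximal_function mu f x `^ p * (w x)%:E)
        <= C1%:E * \int[mu]_x (f x `^ p * w x)%:E)%E) ->
    forall f : X -> R, weighted_Lq mu (p - eps) w f ->
      (\int[mu]_x (maximal_function mu f x `^ (p - eps) * (w x)%:E)
        <= C%:E * \int[mu]_x (`|f x| `^ (p - eps) * w x)%:E)%E].
Proof.
(* C1 may be small or negative; the iteration wants a constant at least 1 *)
pose A := Num.max C1 1; have A1 : 1 <= A by rewrite le_max lexx orbT.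
pose K := 4 * A; have K1 : 1 <= K by rewrite /K; lra.
have c1 : 1 <= cmu by exact: ltW.
have c0 : 0 <= cmu by exact: le_trans ler01 c1.
have c3 : 1 <= cmu ^+ 3 by exact: exprn_ege1.
pose C2 := cmu ^+ 3 * 2; have C21 : 1 <= C2 by rewrite /C2; lra.
have Q0 : 0 < 2 * K ^+ 3 * cmu ^+ 4.
  have K0 : 0 < K by exact: lt_le_trans K1.
  have cmu0 : 0 < cmu by exact: lt_le_trans c1.
  by rewrite mulr_gt0 ?exprn_gt0// mulr_gt0 ?exprn_gt0.
have [|dl [dl0 dl1 dlp hdl]] := exists_small_exponent (t := p - 1) Q0.
  by rewrite subr_gt0.
have d1 : 0 < 1 + dl by rewrite addr_gt0.
have p0 : 0 < p by exact: lt_trans ltr01 hp.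
pose q := p / (1 + dl).
have q0 : 0 < q by rewrite divr_gt0.
pose C3 := C2 `^ (1 + dl) * (8 * K ^+ 2).
have C30 : 0 <= C3.
  have K0 : 0 <= K by exact: le_trans ler01 K1.
  by rewrite mulr_ge0 ?powR_ge0// mulr_ge0 ?exprn_ge0.
exists (p - q), (C3 `^ q * (2 `^ p * (2 * A))); split.
- by rewrite subr_gt0 /q ltr_pdivrMr// ltr_pMr// ltrDl.
- by rewrite ltrD2l ltrN2 /q ltr_pdivlMr// mul1r; lra.
move=> d X mu w H [mw _ wpos] hyp f [mf _].
rewrite (_ : p - (p - q) = q); last by ring.
have [x0 _] := dmms_two_points H.
pose w' x := Num.max (w x) 0.
have w'0 x : 0 <= w' x by rewrite le_max lexx orbT.
have mw' : measurable_fun [set: X] w' by exact: measurable_maxr.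
have strong (g : X -> \bar R) (mg : measurable_fun [set: X] g)
    (g0 : forall x, (0 <= g x)%E) := strong_type_ereal H p0 mw wpos hyp x0 mg g0.
pose F x := `|f x| `^ (1 + dl)^-1.
have F0 x : 0 <= F x by exact: powR_ge0.
have mF : measurable_fun [set: X] F.
  apply: (measurableT_comp (measurable_powR (1 + dl)^-1)).
  exact: measurableT_comp.
have FE x : F x `^ (1 + dl) = `|f x| by rewrite -powRrM mulVf ?gt_eqF// powRr1.
have mEF : measurable_fun [set: X] (EFin \o F) by exact/measurable_EFinP.
have EF0 x : (0 <= (EFin \o F) x)%E by rewrite lee_fin.
pose v := rubio_de_francia mu A (EFin \o F).
have v0 x : (0 <= v x)%E by exact: (rubio_de_francia_ge0 mu A1 EF0).
have Fv : {ae mu, forall x, ((F x)%:E <= C2%:E * v x)%E}.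
  have C20 : 0 < C2 by exact: lt_le_trans C21.
  apply: filterS (le_emaximal_ae H x0 C20 (lexx _) c0 mEF EF0) => x /le_trans; apply.
  by rewrite lee_wpmul2l ?lee_fin ?(ltW C20)//; exact: le_rubio_de_francia.
have dl01 : 0 <= dl <= 1 by rewrite (ltW dl0).
have Mv x : (maximal_function mu f x <= C3%:E * v x `^ (1 + dl))%E.
  rewrite maximal_functionE; apply/(emaximal_leP H) => z r r0 zx.
  under eq_integral => y _ do rewrite -FE.
  apply: (dominated_reverse_hoelder H c1 K1 v0 _ _ dl01 hdl mF F0 C21 Fv r0 zx).
    exact: rubio_de_francia_open.
  by move=> z' r' x'; exact: (integral_ball_rubio_de_francia_le H A1 EF0).
have mMq : measurable_fun [set: X] (fun x => maximal_function mu f x `^ q)%E.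
  exact: (measurableT_comp (measurable_poweR q) (measurable_emaximal H _)).
have mfq : measurable_fun [set: X] (fun x => (`|f x| `^ q)%:E).
  apply/measurable_EFinP; apply: (measurableT_comp (measurable_powR q)).
  exact: measurableT_comp.
have mv : measurable_fun [set: X] v by exact: (measurable_rubio_de_francia H A1 EF0).
have mvp : measurable_fun [set: X] (fun x => v x `^ p * (w' x)%:E)%E.
  apply: emeasurable_funM; last exact/measurable_EFinP.
  exact: (measurableT_comp (measurable_poweR p) mv).
rewrite (integral_weight_pos mw wpos mMq).
under [X in (_ <= _ * X)%E]eq_integral => x _ do rewrite EFinM.
rewrite (integral_weight_pos mw wpos mfq) -/w'.
apply: (@le_trans _ _ (\int[mu]_x ((C3 `^ q)%:E * (v x `^ p * (w' x)%:E)))%E).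
  apply: ge0_le_integral => //.
  - by move=> x _; apply: mule_ge0; [exact: poweR_ge0|rewrite lee_fin; exact: w'0].
  - by apply: emeasurable_funM => //; exact/measurable_EFinP.
  - exact: emeasurable_funM.
  move=> x _; rewrite muleA lee_wpmul2r ?lee_fin ?(w'0 x)//.
  have -> : ((C3 `^ q)%:E * v x `^ p = (C3%:E * v x `^ (1 + dl)) `^ q)%E.
    rewrite poweRM ?poweR_ge0 ?lee_fin// -poweRrM poweR_EFin.
    by rewrite (_ : (1 + dl) * q = p)// /q mulrC divfK ?gt_eqF.
  apply: ge0_le_poweR => //; first exact: ltW.
  by rewrite maximal_functionE; apply: emaximal_ge0 => y; rewrite lee_fin.
rewrite ge0_integralZl_EFin ?powR_ge0//; last first.
  by move=> x _; rewrite mule_ge0 ?poweR_ge0// lee_fin.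
rewrite EFinM -muleA lee_wpmul2l ?lee_fin ?powR_ge0//.
have IE : (\int[mu]_x ((EFin \o F) x `^ p * (w' x)%:E) =
    \int[mu]_x ((`|f x| `^ q)%:E * (w' x)%:E))%E.
  by apply: eq_integral => x _ /=; rewrite /F -powRrM /q (mulrC p).
rewrite -[X in (_ <= _ * X)%E]IE.
exact: (integral_rubio_de_francia_le H A1 (ltW hp) mw' w'0 strong mEF EF0).
Qed.
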